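(* Let $d\ge 1$ be an integer, $\beta\ge 0$ and $h\in\mathbb{R}$ be fixed, and let $\beta_c=\frac1{2d}$. For $n\ge 1$ let $\varepsilon=(\varepsilon_1,\dots,\varepsilon_n)$ be the vector of spins in the Curie-Weiss model on $n$ vertices with parameters $d,\beta,h$, and let $$Q_n^{+}=\sup_{x\in\mathbb{R}}\ \sup_{v_1,\dots,v_n\ge 1}P\Big(\sum_{i=1}^n v_i\varepsilon_i\in(x-1,x+1)\Big).$$ Then, as $n\to+\infty$: (1) If $h=0$ and $\beta<\beta_c$, then $Q_n^{+}\sim\sqrt{\frac{2(1-2d\beta)}{\pi}}\,n^{-1/2}$. (2) If $h=0$ and $\beta=\beta_c$, then $Q_n^{+}\sim\frac{2}{(\frac34)^{1/4}\Gamma(\frac14)}\,n^{-3/4}$. (3) If $h=0$ and $\beta>\beta_c$, then $Q_n^{+}\sim\sqrt{\frac{1/(1-z_*^2)-2d\beta}{2\pi}}\,n^{-1/2}$, where $z_*$ is the maximal solution of the mean-field equation $z=\tanh\big(\frac{\beta}{\beta_c}z\big)$. (4) If $h\ne 0$, then $Q_n^{+}\sim\sqrt{\frac{2(1/(1-z_*^2)-2d\beta)}{\pi}}\,n^{-1/2}$, where $z_*$ is the maximal solution of the mean-field equation $z=\tanh\big(\frac{\beta}{\beta_c}z+|h|\big)$.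
   Context: Curie-Weiss model on $n$ vertices: the spin vector $\varepsilon=(\varepsilon_1,\dots,\varepsilon_n)$ takes values in $\{-1,1\}^n$ with, for $\sigma\in\{-1,1\}^n$, $$P(\varepsilon=\sigma)=\frac{1}{Z_{d,\beta,h}}\exp\Big\{\frac{d\beta}{n}\Big(\sum_{j=1}^n\sigma_j\Big)^2+h\sum_{j=1}^n\sigma_j\Big\},$$ where $Z_{d,\beta,h}$ (depending on $n$) is the normalizing constant. $a_n\sim b_n$ means $a_n/b_n\to 1$. $\Gamma$ is the Gamma function. *)

(* Defs.v *)
From mathcomp Require Import all_boot all_order all_algebra.
From mathcomp Require Import all_classical all_reals all_analysis.

Set Implicit Arguments.
Unset Strict Implicit.
Unset Printing Implicit Defensive.

Import Order.TTheory GRing.Theory Num.Theory.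
Import numFieldNormedType.Exports.

Local Open Scope classical_set_scope.
Local Open Scope ring_scope.

Definition tanh {R : realType} (x : R) : R :=
  (expR x - expR (- x)) / (expR x + expR (- x)).

(* Meaningful for 0 < a: otherwise the integral diverges and Rintegral
   returns the junk value 0. *)
Definition Gamma {R : realType} (a : R) : R :=
  Rintegral (@lebesgue_measure R) `]0, +oo[ (fun t => t `^ (a - 1) * expR (- t)).

Definition asymp_equiv {R : realType} (a b : nat -> R) : Prop :=
  (a n / b n) @[n --> \oo] --> (1 : R).

Definition is_max_solution {R : realType} (f : R -> R) (z : R) : Prop :=
  z = f z /\ (forall w : R, w = f w -> w <= z).

(* The cube {-1,1}^n is encoded by boolean functions on 'I_n, read through
   spin. *)
Definition config (n : nat) := {ffun 'I_n -> bool}.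

Definition spin {R : realType} (b : bool) : R := if b then 1 else -1.

Definition cw_weight {R : realType} (d : nat) (beta h : R) (n : nat)
    (s : config n) : R :=
  expR (d%:R * beta / n%:R * (\sum_(j < n) spin (s j)) ^+ 2
        + h * \sum_(j < n) spin (s j)).

Definition cw_Z {R : realType} (d : nat) (beta h : R) (n : nat) : R :=
  \sum_(s : config n) cw_weight d beta h s.

Definition cw_pmf {R : realType} (d : nat) (beta h : R) (n : nat)
    (s : config n) : R :=
  (cw_Z d beta h n)^-1 * cw_weight d beta h s.

Definition cw_prob {R : realType} (d : nat) (beta h : R) (n : nat)
    (E : pred (config n)) : R :=
  \sum_(s : config n | E s) cw_pmf d beta h s.

Definition Qplus {R : realType} (d : nat) (beta h : R) (n : nat) : R :=
  sup [set sup [set cw_prob d beta h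
                      (fun s => \sum_(i < n) v i * spin (s i) \in `]x - 1, x + 1[)
               | v in [set v : 'I_n -> R | forall i, 1 <= v i]]
      | x in [set: R]].

Definition beta_c {R : realType} (d : nat) : R := 1 / (2 * d%:R).

(* Main.v *)
Require Import Defs.
From mathcomp Require Import all_boot all_order all_algebra.
From mathcomp Require Import all_classical all_reals all_analysis.
From mathcomp Require Import measurable_realfun ring lra zify.
Import Order.TTheory GRing.Theory Num.Theory.
Import numFieldNormedType.Exports.
Local Open Scope classical_set_scope.
Local Open Scope ring_scope.

(** An event [\sum_i v i * spin (s i) \in `]x - 1, x + 1[] with all [v i >= 1]
    selects an antichain of sets of up spins, because raising one spin moves the
    sum by at least 2.  The Gibbs weight depends on the number [k] of up spins
    only, so a configuration at level [k] has probability
    [level_weight k / Z / 'C(n, k)], and [lym_inequality] bounds the probability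
    of an antichain by [\max_k level_weight k / Z].  Unit coefficients reach that
    bound, since then the sum lives on a lattice of step 2.  Hence [Qplus] is
    exactly the largest level probability of the magnetisation
    ([Qplus_le], [level_le_Qplus]), and it remains to compare the largest level
    weight with the sum [Z] of all of them.

    At [y = (2 k + 1 - n) / (n + 1)] the ratio of the binomials at [k + 1] and [k]
    is [(1 - y) / (1 + y) = expR (- 2 artanh y)].  Consequently
    ([level_weight_step]) the logarithm of the ratio of consecutive level weights
    is exactly [2 g y + 2 b y / n], where [b = 2 d beta] and
    [g y = b y + h - artanh y] is the mean-field function, whose zeros solve the
    mean-field equation.  Laplace's method is run on these increments.  For
    [h >= 0] the sum is folded onto magnetisations [y >= 0], where
    [g] is concave, so that there is one peak, at the largest zero [z] of [g].

    If [g (z + x)] is equivalent to [- kappa x ^ (p + 1)] near 0, the increments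
    at distance [j] from the peak are about [- 2 kappa (2 j / n) ^ (p + 1)].  They
    sum up to a quantity of order 1 when [j] is of order
    [s = n ^ ((p + 1) / (p + 2))], and dominated convergence ([cvg_laplace_sum])
    shows that each side of the peak contributes [s] times the integral over
    [0, +oo[ of [expR (- 2 ^ (p + 2) kappa / (p + 2) t ^ (p + 2))], relative to the
    largest weight.  Away from criticality [p = 0] and [kappa = 1 / (1 - z ^ 2) - b]
    is positive, which gives a Gauss integral; at [b = 1], [h = 0] the linear term
    vanishes, [g y] is about [- y ^ 3 / 3], so [p = 2] and the integral is a value
    of [Gamma] at [1 / 4].

    The constants then count half-peaks: two for [h = 0] and [b <= 1], four for
    [h = 0] and [b > 1] (two symmetric peaks, at [z] and [- z]), and two for
    [h > 0], where the levels near [- z] have exponentially small relative weight.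
    The sign of [h] is immaterial by the symmetry [Qplus_norm]. *)

(** * Antichains and the levels of the magnetisation *)

Definition antichain {T : finType} (F : {set {set T}}) :=
  forall A B, A \in F -> B \in F -> A \subset B -> A = B.

(** Induction on the ground set: if [E] is not a member of [F], the members that
    avoid a point [i] of [E] form an antichain in [E :\ i], and averaging the
    induction hypothesis over [i] gives the claim. *)
Lemma lym_inequality (R : realFieldType) (T : finType) (F : {set {set T}})
    (E : {set T}) :
  antichain F -> (forall A, A \in F -> A \subset E) ->
  \sum_(A in F) ('C(#|E|, #|A|)%:R)^-1 <= 1 :> R.
Proof.
move: E F.
have inE_case n (E : {set T}) (F : {set {set T}}) : #|E| = n -> antichain F ->
    (forall A, A \in F -> A \subset E) -> E \in F ->
    \sum_(A in F) ('C(n, #|A|)%:R)^-1 <= 1 :> R.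
  move=> En antiF FE EF.
  rewrite (bigD1 E)//= En binn invr1 big1 ?addr0// => A /andP[AF AE].
  by have := antiF _ _ AF EF (FE _ AF); move/eqP; rewrite (negbTE AE).
move=> E F; move En : #|E| => n; elim: n E En F => [|n IH] E En F antiF FE.
  have [|EF] := boolP (E \in F); first exact: inE_case.
  have E0 : E = finset.set0 by apply/eqP; rewrite -cards_eq0 En.
  rewrite big1 // => A AF; move: (AF) EF; have := FE _ AF.
  by rewrite E0 finset.subset0 => /eqP -> ->.
have [|EF] := boolP (E \in F); first exact: inE_case.
have ltA A : A \in F -> (#|A| <= n)%N.
  move=> AF; rewrite -ltnS -En proper_card// finset.properEneq FE// andbT.
  by apply: contra EF => /eqP <-.
have n0 : (n.+1%:R : R) != 0 by rewrite pnatr_eq0.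
(* of the n + 1 points of E, exactly n + 1 - |A| lie outside A *)
have step A : A \in F -> ('C(n.+1, #|A|)%:R)^-1 =
    \sum_(i in E | i \notin A) (n.+1%:R)^-1 * ('C(n, #|A|)%:R)^-1 :> R.
  move=> AF; rewrite big_const_seq/= iter_addr_0.
  have -> : count (fun i => (i \in E) && (i \notin A)) (index_enum T) =
      (n.+1 - #|A|)%N.
    rewrite -sum1_count -En -(cardsDS (FE _ AF)) -sum1_card.
    by apply: eq_bigl => i; rewrite !inE andbC.
  have /(congr1 (fun m => m%:R : R)) := mul_bin_down n.+1 #|A|.
  rewrite !natrM => H.
  have b1 : ('C(n, #|A|)%:R : R) != 0 by rewrite pnatr_eq0 -lt0n bin_gt0 ltA.
  have b2 : ('C(n.+1, #|A|)%:R : R) != 0.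
    by rewrite pnatr_eq0 -lt0n bin_gt0 leqW// ltA.
  rewrite -[RHS]mulr_natr -invfM H invfM mulrC mulVKf//.
  by rewrite pnatr_eq0 -lt0n subn_gt0 ltnS ltA.
rewrite (eq_bigr _ step) (exchange_big_dep (mem E))/=; last first.
  by move=> A i _ /andP[].
apply: (@le_trans _ _ (\sum_(i in E) (n.+1%:R)^-1)); last first.
  by rewrite sumr_const En -[leLHS]mulr_natr mulVf.
apply: ler_sum => i iE.
rewrite -mulr_sumr -[leRHS]mulr1 ler_wpM2l ?invr_ge0 ?ler0n//.
pose G := [set A in F | i \notin A]%SET.
rewrite (eq_bigl (fun A => A \in G)); last by move=> A; rewrite iE !inE.
apply: (IH (E :\ i)%SET _ G).
- by move: En; rewrite (cardsD1 i) iE => -[].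
- by move=> A B /[!inE] /andP[AF _] /andP[BF _]; exact: antiF.
- move=> A /[!inE] /andP[AF iA]; apply/fintype.subsetP => j jA.
  rewrite !inE (fintype.subsetP (FE _ AF))// andbT.
  by apply: contra iA => /eqP <-.
Qed.

Definition up_count {n} (s : config n) : nat := #|[set i | s i]%SET|.

Lemma sum_spin (R : realType) n (s : config n) :
  \sum_(j < n) spin (s j) = 2 * (up_count s)%:R - n%:R :> R.
Proof.
have -> : up_count s = (\sum_(i | s i) 1)%N.
  by rewrite /up_count -sum1_card; apply: eq_bigl => i; rewrite inE.
rewrite natr_sum mulr_sumr.
rewrite (eq_bigr (fun j => 2 * (s j)%:R - 1)); last first.
  by move=> j _; rewrite /spin; case: (s j) => /=; ring.
rewrite sumrB sumr_const card_ord; congr (_ - _).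
rewrite (big_mkcond (fun i => s i)); apply: eq_bigr => i _.
by case: (s i) => //=; rewrite mulr0.
Qed.

(** The Gibbs weight of the event [up_count = k], with [b] for [2 d beta]. *)
Definition level_weight {R : realType} (b h : R) (n k : nat) : R :=
  'C(n, k)%:R * expR (b / (2 * n%:R) * (2 * k%:R - n%:R) ^+ 2
                      + h * (2 * k%:R - n%:R)).

Section Levels.
Context {R : realType} (d : nat) (beta h : R) (n : nat).
Let b := 2 * d%:R * beta.

Lemma cw_weightE (s : config n) :
  cw_weight d beta h s =
  expR (b / (2 * n%:R) * (2 * (up_count s)%:R - n%:R) ^+ 2
        + h * (2 * (up_count s)%:R - n%:R)).
Proof.
have -> : b / (2 * n%:R) = d%:R * beta / n%:R.
  by rewrite /b -[2 * _ * _]mulrA -mulf_div divff ?mul1r// pnatr_eq0.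
by rewrite /cw_weight sum_spin.
Qed.

Lemma up_count_le (s : config n) : (up_count s <= n)%N.
Proof. by rewrite /up_count -[leqRHS]card_ord max_card. Qed.

Lemma cw_weight_level (s : config n) :
  cw_weight d beta h s =
  ('C(n, up_count s)%:R)^-1 * level_weight b h n (up_count s).
Proof.
rewrite cw_weightE /level_weight mulKf// pnatr_eq0 -lt0n bin_gt0.
exact: up_count_le.
Qed.

Definition set_of_config (s : config n) : {set 'I_n} := [set i | s i]%SET.

Lemma set_of_config_bij : bijective set_of_config.
Proof.
exists (fun A : {set 'I_n} => [ffun i => i \in A]) => [s|A].
  by apply/ffunP => i; rewrite ffunE inE.
by apply/setP => i; rewrite inE ffunE.
Qed.

Lemma card_up_count k : #|[pred s : config n | up_count s == k]| = 'C(n, k).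
Proof.
rewrite -[n in RHS]card_ord -cardsT -(cards_draws _ k) -sum1_card -sum1_card.
rewrite [RHS](reindex set_of_config); last exact/onW_bij/set_of_config_bij.
by apply: eq_bigl => s; rewrite !inE finset.subsetT.
Qed.

Lemma cw_prob_level k : (k <= n)%N ->
  cw_prob d beta h (fun s : config n => up_count s == k) =
  level_weight b h n k / cw_Z d beta h n.
Proof.
move=> kn; rewrite /cw_prob /cw_pmf -mulr_sumr mulrC; congr (_ / _).
rewrite (eq_bigr (fun=> ('C(n, k)%:R)^-1 * level_weight b h n k)); last first.
  by move=> s /eqP <-; rewrite cw_weight_level.
transitivity (('C(n, k)%:R)^-1 * level_weight b h n k *+
    #|[pred s : config n | up_count s == k]|); first exact: sumr_const.
rewrite card_up_count -[LHS]mulr_natl mulVKf//.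
by rewrite pnatr_eq0 -lt0n bin_gt0.
Qed.

Lemma cw_Z_level : cw_Z d beta h n = \sum_(k < n.+1) level_weight b h n k.
Proof.
rewrite /cw_Z (partition_big (fun s => inord (up_count s) : 'I_n.+1) xpredT)//.
apply: eq_bigr => k _.
rewrite (eq_bigr (fun=> ('C(n, k)%:R)^-1 * level_weight b h n k)); last first.
  move=> s /eqP <-; rewrite cw_weight_level inordK//.
  by rewrite ltnS up_count_le.
rewrite sumr_const (eq_card (B := [pred s : config n | up_count s == k])).
  rewrite card_up_count -[LHS]mulr_natl mulVKf//.
  by rewrite pnatr_eq0 -lt0n bin_gt0 -ltnS ltn_ord.
move=> s; rewrite inE [RHS]inE; apply/eqP/eqP => [<-|->].
  by apply/esym/inordK; rewrite ltnS up_count_le.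
exact: (congr1 val (inord_val k)).
Qed.

Lemma cw_Z_gt0 : 0 < cw_Z d beta h n.
Proof.
rewrite /cw_Z (bigD1 [ffun=> true])//=.
rewrite ltr_pwDl ?expR_gt0//; apply: sumr_ge0 => s _; exact: expR_ge0.
Qed.

(** Raising a spin moves the sum by at least 2, so an open interval of length
    2 selects an antichain of sets of up spins. *)
Lemma interval_antichain (v : 'I_n -> R) x : (forall i, 1 <= v i) ->
  antichain [set A : {set 'I_n} |
    \sum_(i < n) v i * spin (i \in A) \in `]x - 1, x + 1[]%SET.
Proof.
move=> v1 A B; rewrite 2!finset.in_set => Ax Bx AB; apply/eqP; rewrite finset.eqEsubset AB/=.
apply/negPn/negP => /fintype.subsetPn[i iB iA].
move: Ax Bx; rewrite !in_itv/= => /andP[Ax _] /andP[_ Bx].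
have : \sum_(j < n) v j * spin (j \in A) + 2 <=
       \sum_(j < n) v j * spin (j \in B).
  rewrite (bigD1 i)//= [leRHS](bigD1 i)//= iB (negbTE iA) /spin.
  rewrite addrAC lerD//.
    by have := v1 i; lra.
  apply: ler_sum => j _; have := v1 j.
  have [jA|] := boolP (j \in A); first by rewrite (fintype.subsetP AB _ jA).
  by case: (j \in B) => _; lra.
lra.
Qed.

(** A set [A] of up spins has probability [level_weight #|A| / Z / 'C(n, #|A|)],
    at most [M / 'C(n, #|A|)], and these bounds add up to [M] at most over an
    antichain. *)
Lemma cw_prob_interval_le (v : 'I_n -> R) x M : (forall i, 1 <= v i) ->
  (forall k, (k <= n)%N -> level_weight b h n k / cw_Z d beta h n <= M) ->
  cw_prob d beta h
    (fun s => \sum_(i < n) v i * spin (s i) \in `]x - 1, x + 1[) <= M.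
Proof.
move=> v1 lM.
have M0 : 0 <= M.
  apply: le_trans (lM 0%N _) => //; rewrite divr_ge0 ?(ltW cw_Z_gt0)//.
  by rewrite mulr_ge0 ?expR_ge0 ?ler0n.
set F := [set A : {set 'I_n} |
    \sum_(i < n) v i * spin (i \in A) \in `]x - 1, x + 1[]%SET.
apply: (@le_trans _ _ (M * \sum_(A in F) ('C(n, #|A|)%:R)^-1)); last first.
  rewrite -[leRHS]mulr1 ler_wpM2l//.
  have := @lym_inequality R _ F [set: 'I_n]%SET (interval_antichain v x v1).
  by rewrite cardsT card_ord; apply => A _; rewrite finset.subsetT.
rewrite mulr_sumr (reindex set_of_config)/=; last first.
  exact/onW_bij/set_of_config_bij.
rewrite /cw_prob big_mkcond [leRHS]big_mkcond/=; apply: ler_sum => s _.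
have -> : (set_of_config s \in F) =
    (\sum_(i < n) v i * spin (s i) \in `]x - 1, x + 1[).
  by rewrite inE; under eq_bigr do rewrite inE.
case: ifP => // _; rewrite /cw_pmf cw_weight_level mulrCA mulrC.
by rewrite ler_wpM2r ?invr_ge0 ?ler0n// mulrC lM// up_count_le.
Qed.

Lemma Qplus_le M :
  (forall k, (k <= n)%N -> level_weight b h n k / cw_Z d beta h n <= M) ->
  Qplus d beta h n <= M.
Proof.
move=> lM; apply: ge_sup; first by eexists; exists 0.
move=> _ [x _ <-]; apply: ge_sup.
  by eexists; exists (fun=> 1) => //= i.
by move=> _ [v /= v1 <-]; exact: cw_prob_interval_le.
Qed.

(** With unit coefficients the sum lives on a lattice of step 2, so the
    interval centred at [2 k - n] captures exactly one level.  The bound [M] only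
    serves to show that the suprema are those of bounded sets. *)
Lemma level_le_Qplus k : (k <= n)%N ->
  level_weight b h n k / cw_Z d beta h n <= Qplus d beta h n.
Proof.
move=> kn.
pose M := \sum_(k < n.+1) level_weight b h n k / cw_Z d beta h n.
have lM j : (j <= n)%N -> level_weight b h n j / cw_Z d beta h n <= M.
  move=> jn; rewrite /M (bigD1 (inord j))//= inordK ?ltnS// lerDl.
  apply: sumr_ge0 => i _; rewrite divr_ge0 ?(ltW cw_Z_gt0)//.
  by rewrite mulr_ge0 ?expR_ge0 ?ler0n.
pose S x := [set cw_prob d beta h
    (fun s : config n => \sum_(i < n) v i * spin (s i) \in `]x - 1, x + 1[)
    | v in [set v : 'I_n -> R | forall i, 1 <= v i]].
have Sub x : has_sup (S x).
  split; first by eexists; exists (fun=> 1) => //= i.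
  by exists M => _ [v /= v1 <-]; exact: cw_prob_interval_le.
rewrite -cw_prob_level//.
apply: (@le_trans _ _ (sup (S (2 * k%:R - n%:R)))).
  apply: ub_le_sup; first by case: (Sub (2 * k%:R - n%:R)).
  exists (fun=> 1) => //=; apply: eq_bigl => s.
  rewrite (eq_bigr (fun i => spin (s i))) => [|i _]; last by rewrite mul1r.
  rewrite sum_spin in_itv/=; apply/andP/eqP => [[lo hi]|->]; last by split; lra.
  apply/eqP; rewrite eqn_leq; apply/andP; split; rewrite -ltnS.
    by rewrite -(ltr_nat R) -[k.+1]addn1 natrD; lra.
  by rewrite -(ltr_nat R) -[(up_count s).+1]addn1 natrD; lra.
apply: ub_le_sup; last by exists (2 * k%:R - n%:R).
exists M => _ [x _ <-]; apply: ge_sup; first by case: (Sub x).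
by move=> _ [v /= v1 <-]; exact: cw_prob_interval_le.
Qed.

End Levels.

(** * The mean-field function *)

Section Artanh.
Context {R : realType}.
Implicit Types x y u : R.

Definition artanh y : R := ln ((1 + y) / (1 - y)) / 2.

Lemma expR_2artanh y : -1 < y < 1 -> expR (2 * artanh y) = (1 + y) / (1 - y).
Proof.
move=> /andP[y1 y2]; rewrite /artanh mulrC divfK ?pnatr_eq0// lnK//.
by rewrite posrE divr_gt0//; lra.
Qed.

Lemma artanh0 : artanh 0 = 0.
Proof. by rewrite /artanh addr0 subr0 divr1 ln1 mul0r. Qed.

Lemma tanh_itv u : -1 < tanh u < 1.
Proof.
rewrite /tanh; have a0 := expR_gt0 u; have b0 := expR_gt0 (- u).
by rewrite ltr_pdivlMr ?addr_gt0// ltr_pdivrMr ?addr_gt0//; lra.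
Qed.

Lemma tanhK u : artanh (tanh u) = u.
Proof.
have a0 := expR_gt0 u; have b0 := expR_gt0 (- u).
rewrite /artanh.
have -> : (1 + tanh u) / (1 - tanh u) = expR (2 * u).
  have -> : expR (2 * u) = expR u / expR (- u).
    by rewrite [expR (- u)]expRN invrK -expRD; congr expR; ring.
  rewrite /tanh; field; rewrite !gt_eqF//=; lra.
by rewrite expRK mulrC mulKf.
Qed.

Lemma artanhK y : -1 < y < 1 -> tanh (artanh y) = y.
Proof.
move=> y1; have := y1 => /andP[y2 y3].
have -> : tanh (artanh y) = (expR (2 * artanh y) - 1) / (expR (2 * artanh y) + 1).
  have a0 := expR_gt0 (artanh y).
  have -> : expR (2 * artanh y) = expR (artanh y) ^+ 2.
    by rewrite expr2 -expRD; congr expR; ring.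
  have p1 : expR (artanh y) ^+ 2 + 1 != 0.
    by rewrite gt_eqF// ltr_wpDl// exprn_ge0// ltW.
  rewrite /tanh expRN; field; by rewrite p1 gt_eqF.
rewrite expR_2artanh//; field; apply/andP; split.
  by rewrite gt_eqF//; lra.
by rewrite gt_eqF//; lra.
Qed.

Lemma artanh_le x y : -1 < x -> x <= y -> y < 1 -> artanh x <= artanh y.
Proof.
move=> x1 xy y1; rewrite /artanh ler_pM2r// ler_ln ?posrE ?divr_gt0//; try lra.
rewrite ler_pdivrMr; last by lra.
rewrite mulrAC ler_pdivlMr; last by lra.
by nra.
Qed.

Lemma is_derive_artanh y : -1 < y < 1 -> is_derive y 1 artanh (1 - y ^+ 2)^-1.
Proof.
move=> /andP[y1 y2].
have P1 : 0 < 1 + y by lra.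
have P2 : 0 < 1 - y by lra.
have d1 : is_derive y 1 (fun x : R => ln (1 + x)) (1 + y)^-1.
  have H : is_derive y 1 (fun x : R => 1 + x) 1.
    have : is_derive y 1 (cst 1 + id : R -> R) (0 + 1) by exact: is_deriveD.
    by rewrite add0r.
  have := @is_derive1_comp R (@ln R) (fun x => 1 + x) y _ _ (is_derive1_ln P1) H.
  by rewrite mulr1.
have d2 : is_derive y 1 (fun x : R => ln (1 - x)) (- (1 - y)^-1).
  have H : is_derive y 1 (fun x : R => 1 - x) (-1).
    have : is_derive y 1 (cst 1 - id : R -> R) (0 - 1) by exact: is_deriveB.
    by rewrite sub0r.
  have := @is_derive1_comp R (@ln R) (fun x => 1 - x) y _ _ (is_derive1_ln P2) H.
  by rewrite mulrN1.
have d3 : is_derive y 1 (2^-1 *: ((fun x : R => ln (1 + x)) - (fun x : R => ln (1 - x))))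
    (2^-1 *: ((1 + y)^-1 - (- (1 - y)^-1))).
  exact: is_deriveZ.
have -> : (1 - y ^+ 2)^-1 = 2^-1 *: ((1 + y)^-1 - (- (1 - y)^-1)).
  rewrite /GRing.scale/=; field; apply/and3P; split; rewrite gt_eqF//.
  by rewrite (_ : 1 - y ^+ 2 = (1 + y) * (1 - y)) ?mulr_gt0//; ring.
apply: near_eq_is_derive d3.
near=> x; rewrite /artanh lnM ?posrE ?invr_gt0; first last.
- by rewrite subr_gt0; near: x; exact: lt_nbhsl.
- suff : -1 < x by lra.
  by near: x; exact: lt_nbhsr.
rewrite lnV ?posrE; last by rewrite subr_gt0; near: x; exact: lt_nbhsl.
by rewrite mulrC.
Unshelve. all: by end_near. Qed.

End Artanh.

Section MeanField.
Context {R : realType} (b h : R).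
Implicit Types x y : R.

(** The derivative of [b * y ^+ 2 / 2 + h * y - I y], where [I], with derivative
    [artanh], is the entropy cost of the magnetisation [y] for independent fair
    spins. *)
Definition mf_field y : R := b * y + h - artanh y.
Local Notation g := mf_field.

Lemma is_derive_mf_field y : -1 < y < 1 -> is_derive y 1 g (b - (1 - y ^+ 2)^-1).
Proof.
move=> y1; have Da := is_derive_artanh _ y1.
have D1 : is_derive y 1 (b *: id + cst h : R -> R) (b *: 1 + 0) by exact: is_deriveD.
have : is_derive y 1 ((b *: id + cst h : R -> R) - artanh)
   (b *: 1 + 0 - (1 - y ^+ 2)^-1) by exact: is_deriveB.
by rewrite addr0 /GRing.scale/= mulr1.
Qed.

Lemma mf_field_MVT x y : -1 < x -> x < y -> y < 1 ->
  exists2 t, x < t < y & g y - g x = (b - (1 - t ^+ 2)^-1) * (y - x).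
Proof.
move=> x1 xy y1.
have in11 t : t \in `[x, y] -> -1 < t < 1.
  by rewrite in_itv/= => /andP[xt ty]; rewrite (lt_le_trans x1)// (le_lt_trans ty).
have dg t : t \in `]x, y[ -> is_derive t 1 g (b - (1 - t ^+ 2)^-1).
  by move=> txy; apply: is_derive_mf_field; apply: in11; exact: subset_itv_oo_cc.
have cg : {within `[x, y], continuous g}.
  by apply: derivable_within_continuous => t /in11/is_derive_mf_field [].
have [t] := MVT xy dg cg.
by rewrite in_itv/= => txy E; exists t.
Qed.

Lemma mf_field_slope_lt x y : 0 <= x -> x < y -> y < 1 ->
  b - (1 - y ^+ 2)^-1 < b - (1 - x ^+ 2)^-1.
Proof.
move=> x0 xy y1; have y0 : 0 < y by exact: le_lt_trans xy.
have e1 : 0 < 1 - y ^+ 2 by nra.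
have e2 : 0 < 1 - x ^+ 2 by nra.
by rewrite ltrD2l ltrN2 ltf_pV2 ?posrE//; nra.
Qed.

(** Strict concavity on [[0, 1[], as the comparison of two chords: their slopes
    are values of the decreasing derivative. *)
Lemma mf_field_concave x y w : 0 <= x -> x < y -> y < w -> w < 1 ->
  (g w - g y) * (y - x) < (g y - g x) * (w - y).
Proof.
move=> x0 xy yw w1.
have [t1 /andP[xt1 t1y] E1] := @mf_field_MVT x y (lt_le_trans (ltrN10 _) x0) xy (lt_trans yw w1).
have y0 : 0 < y by exact: le_lt_trans xy.
have [t2 /andP[yt2 t2w] E2] := @mf_field_MVT y w (lt_trans (ltrN10 _) y0) yw w1.
have := @mf_field_slope_lt t1 t2 (le_trans x0 (ltW xt1)) (lt_trans t1y yt2) (lt_trans t2w w1).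
rewrite E1 E2 => H; rewrite -mulrA [ltRHS]mulrAC -[ltRHS]mulrA.
by rewrite ltr_pM2r// mulr_gt0// subr_gt0.
Qed.

Lemma mf_field_tangent z y : 0 <= z -> g z = 0 -> z <= y -> y < 1 ->
  g y <= - ((1 - z ^+ 2)^-1 - b) * (y - z).
Proof.
move=> z0 gz; rewrite le_eqVlt => /predU1P[<- _|zy y1].
  by rewrite gz subrr mulr0.
have [t /andP[zt ty] E] := @mf_field_MVT z y (lt_le_trans (ltrN10 _) z0) zy y1.
move: E; rewrite gz subr0 => ->; rewrite ler_pM2r ?subr_gt0// opprB.
exact/ltW/mf_field_slope_lt/(lt_trans ty).
Qed.

Lemma mf_field_local z eps : -1 < z < 1 -> g z = 0 -> 0 < eps ->
  exists2 delta, 0 < delta & forall x, `|x| <= delta ->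
  `|g (z + x) + ((1 - z ^+ 2)^-1 - b) * x| <= eps * `|x|.
Proof.
move=> z1 gz e0; have [dg Eg] := is_derive_mf_field z z1.
have : (fun k => k^-1 *: ((g \o shift z) (k *: 1) - g z)) @ 0^' --> b - (1 - z ^+ 2)^-1.
  by rewrite -Eg; exact: dg.
move=> /cvgrPdist_le /(_ _ e0) [d /= d0 Hd].
exists (d / 2); first by rewrite divr_gt0.
move=> x xd; have [->|x0] := eqVneq x 0.
  by rewrite addr0 gz mulr0 addr0 !normr0 mulr0.
have {Hd} := Hd x _ x0; rewrite /ball_ /= sub0r normrN => H.
have {H} : `|b - (1 - z ^+ 2)^-1 - x^-1 *: (g (x *: 1 + z) - g z)| <= eps.
  by apply: H; apply: le_lt_trans xd _; rewrite ltr_pdivrMr//; lra.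
rewrite gz subr0 /GRing.scale/= mulr1 addrC => H.
have x1 : 0 < `|x| by rewrite normr_gt0.
rewrite -ler_pdivrMr// -normfV -normrM.
rewrite -normrN; move: H; congr (`| _ | <= _).
rewrite [x + z]addrC; move: ((1 - z ^+ 2)^-1) (g _) => A B; field; exact: x0.
Qed.

Section PositiveRoot.
Context (z : R) (z0 : 0 < z) (z1 : z < 1) (gz : g z = 0) (h0 : 0 <= h).

Lemma mf_field0 : g 0 = h.
Proof. by rewrite /mf_field mulr0 add0r artanh0 subr0. Qed.

(** Between 0 and [z] the field falls from [h >= 0] to 0, so its slope is
    nonpositive somewhere before [z], and slopes decrease. *)
Lemma mf_curvature_gt0 : 0 < (1 - z ^+ 2)^-1 - b.
Proof.
have [t /andP[t0 tz] E] := @mf_field_MVT 0 z (ltrN10 _) z0 z1.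
have := mf_field_slope_lt t z (ltW t0) tz z1.
move: E; rewrite gz mf_field0 sub0r subr0 => E.
have : b - (1 - t ^+ 2)^-1 <= 0 by rewrite -(pmulr_lle0 _ z0) -E oppr_le0.
lra.
Qed.

Lemma mf_field_ge0 y : 0 <= y <= z -> 0 <= g y.
Proof.
move=> /andP[]; rewrite le_eqVlt => /predU1P[<- _|y0]; first by rewrite mf_field0.
rewrite le_eqVlt => /predU1P[->|yz]; first by rewrite gz.
have := @mf_field_concave 0 y z (lexx _) y0 yz z1.
rewrite gz mf_field0 !subr0 sub0r => H.
have : 0 <= h * (z - y) by rewrite mulr_ge0// subr_ge0 ltW.
by rewrite -(pmulr_lge0 _ z0); nra.
Qed.

(** At 0 the field may vanish, hence no linear lower bound holds on all of
    [[0, z]]; from [z / 2] on, the chord down to the root provides one. *)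
Lemma mf_field_mid : 0 < g (z / 2).
Proof.
have := @mf_field_concave 0 (z / 2) z (lexx _).
rewrite gz mf_field0 subr0 sub0r => /(_ _ _ z1) H.
have {H} : - g (z / 2) * (z / 2) < (g (z / 2) - h) * (z - z / 2).
  by apply: H; move: z0; lra.
have -> : z - z / 2 = z / 2 by lra.
by rewrite ltr_pM2r ?divr_gt0//; move: h0; lra.
Qed.

Lemma mf_field_chord y : z / 2 <= y <= z ->
  g (z / 2) / (z / 2) * (z - y) <= g y.
Proof.
have z2 : 0 < z / 2 by rewrite divr_gt0.
move=> /andP[]; rewrite le_eqVlt => /predU1P[<- _|y0].
  have -> : z - z / 2 = z / 2 by lra.
  by rewrite divfK// gt_eqF.
rewrite le_eqVlt => /predU1P[->|yz]; first by rewrite gz subrr mulr0.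
have := @mf_field_concave (z / 2) y z (ltW z2) y0 yz z1.
rewrite gz sub0r => H; rewrite mulrAC ler_pdivrMr//; nra.
Qed.

End PositiveRoot.

Lemma mf_fixpointP w : w = tanh (b * w + h) <-> -1 < w < 1 /\ g w = 0.
Proof.
split=> [E|[w1 gw]].
  split; first by rewrite E tanh_itv.
  by rewrite /mf_field [in artanh _]E tanhK subrr.
by move/eqP: gw; rewrite subr_eq0 => /eqP ->; rewrite artanhK.
Qed.

(** Past a root with negative slope, the field stays below its tangent, so it
    has no further zero. *)
Lemma mf_root_max z : 0 <= z < 1 -> g z = 0 -> b < (1 - z ^+ 2)^-1 ->
  is_max_solution (fun w => tanh (b * w + h)) z.
Proof.
move=> /andP[z0 z1] gz a0; split.
  by apply/mf_fixpointP; rewrite z1 (lt_le_trans (ltrN10 _)).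
move=> w /mf_fixpointP[/andP[w0 w1] gw]; rewrite leNgt; apply/negP => zw.
have := mf_field_tangent z w z0 gz (ltW zw) w1; rewrite gw mulNr oppr_ge0.
by rewrite leNgt mulr_gt0// subr_gt0.
Qed.

Lemma continuous_tanh : continuous (@tanh R).
Proof.
move=> x; apply: cvgM.
  apply: cvgB; first exact: continuous_expR.
  by apply: continuous_comp; [exact: opp_continuous|exact: continuous_expR].
apply: cvgV; first by rewrite gt_eqF// addr_gt0// expR_gt0.
apply: cvgD; first exact: continuous_expR.
by apply: continuous_comp; [exact: opp_continuous|exact: continuous_expR].
Qed.

(** By the intermediate value theorem, [tanh (b * w + h) - w] being negative at
    1: it is positive at 0 if [h > 0], and at a small positive point if [h = 0]
    and the slope [b] at 0 exceeds 1. *)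
Lemma mf_root_exists : 0 < h \/ h = 0 /\ 1 < b -> 0 <= b ->
  exists z, [/\ 0 < z, z < 1 & g z = 0].
Proof.
move=> hb b0; pose F w := tanh (b * w + h) - w.
have cF : continuous F.
  move=> x; apply: cvgB; last exact: cvg_id.
  apply: (@continuous_comp _ _ _ (fun w => b * w + h) (@tanh R)); last exact: continuous_tanh.
  by apply: cvgD; [apply: cvgM; [exact: cvg_cst|exact: cvg_id]|exact: cvg_cst].
have [y0 [y00 y01 Fy0]] : exists y0, [/\ 0 <= y0, y0 < 1 & 0 < F y0].
  case: hb => [h0|[h0 b1]].
    exists 0; split => //; rewrite /F mulr0 add0r subr0 /tanh.
    apply: divr_gt0; last by rewrite addr_gt0// expR_gt0.
    by rewrite subr_gt0 ltr_expR; lra.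
  have bV : b^-1 < 1 by rewrite invf_lt1// (lt_trans ltr01).
  have bV0 : 0 < b^-1 by rewrite invr_gt0 (lt_trans ltr01).
  exists ((1 - b^-1) / 2); set y := _ / 2.
  have y0 : 0 < y by rewrite /y divr_gt0//; lra.
  have y1 : y < 1 by rewrite /y; lra.
  split => //; first exact: ltW.
  rewrite /F h0 addr0 subr_gt0 ltNge; apply/negP => ty.
  have /andP[t1 _] := tanh_itv (b * y).
  have := artanh_le _ _ t1 ty y1; rewrite tanhK leNgt => /negP; apply.
  (* artanh y <= y / (1 - y) and 1 / (1 - y) < b *)
  have : artanh y <= y / (1 - y).
    have -> : y / (1 - y) = (2 * y / (1 - y)) / 2 by field; rewrite gt_eqF//; lra.
    rewrite /artanh ler_pM2r//.
    have -> : (1 + y) / (1 - y) = 1 + 2 * y / (1 - y) by field; rewrite gt_eqF//; lra.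
    apply: le_ln1Dx; apply: lt_trans (ltrN10 _) _.
    by rewrite divr_gt0 ?mulr_gt0//; lra.
  move/le_lt_trans; apply; rewrite mulrC ltr_pM2r//.
  rewrite -[ltRHS]invrK ltf_pV2 ?posrE//; first by rewrite /y; lra.
  by lra.
have F1 : F 1 < 0.
  by have /andP[_] := tanh_itv (b * 1 + h); rewrite /F; lra.
have F01 : Num.min (F y0) (F 1) <= 0 <= Num.max (F y0) (F 1).
  by rewrite ge_min le_max (ltW F1) (ltW Fy0) orbT.
have [z] := IVT (ltW y01) (continuous_subspaceT cF) F01.
rewrite in_itv/= => /andP[y0z _] /eqP; rewrite subr_eq0 => /eqP/esym Ez.
have [/andP[_ z1] gz] := (mf_fixpointP z).1 Ez.
exists z; split => //; rewrite lt_neqAle (le_trans y00 y0z) andbT eq_sym.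
apply/eqP => zE; move: y0z Fy0; rewrite zE => y0z.
have -> : y0 = 0 by apply/eqP; rewrite eq_le y00 y0z.
by move: Ez; rewrite zE => E; rewrite /F -E subrr ltxx.
Qed.

End MeanField.

Section Critical.
Context {R : realType}.
Implicit Types y : R.

(** The function [y + y ^+ 3 / 3 - artanh y] has derivative
    [- y ^+ 4 / (1 - y ^+ 2)]. *)
Lemma artanh_cubic y : 0 <= y -> y < 1 ->
  y ^+ 3 / 3 <= artanh y - y /\ (y <= 2^-1 -> artanh y - y <= y ^+ 3 / 3 + 2 * y ^+ 5).
Proof.
rewrite le_eqVlt => /predU1P[<- _|y0 y1].
  by rewrite artanh0 !expr0n/= !mul0r !subr0 mulr0 addr0.
pose F t : R := mf_field 1 0 t + 3^-1 * t ^+ 3.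
have in11 (t : R) : t \in `[0, y] -> -1 < t < 1.
  by rewrite in_itv/= => /andP[xt ty]; rewrite (lt_le_trans (ltrN10 _))// (le_lt_trans ty).
have dF (t : R) : -1 < t < 1 -> is_derive t 1 F (1 - (1 - t ^+ 2)^-1 + t ^+ 2).
  move=> t1; have d1 := is_derive_mf_field 1 0 t t1.
  have d2 : is_derive t 1 (3^-1 *: (id ^+ 3 : R -> R))
      (3^-1 *: ((3%:R * id t ^+ 2) *: 1)) by exact: is_deriveZ.
  have d3 : is_derive t 1 ((mf_field 1 0 : R -> R) + 3^-1 *: (id ^+ 3 : R -> R))
     (1 - (1 - t ^+ 2)^-1 + 3^-1 *: ((3%:R * id t ^+ 2) *: 1)) by exact: is_deriveD.
  have {}d3 : is_derive t 1 F
     (1 - (1 - t ^+ 2)^-1 + 3^-1 *: ((3%:R * id t ^+ 2) *: 1)) by exact: d3.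
  apply: is_derive_eq d3 _; congr (_ + _).
  by rewrite /GRing.scale/=; field.
have dF' t : t \in `]0, y[ -> is_derive t 1 F (1 - (1 - t ^+ 2)^-1 + t ^+ 2).
  by move=> t1; apply: dF; apply: in11; exact: subset_itv_oo_cc.
have cF : {within `[0, y], continuous F}.
  by apply: derivable_within_continuous => t /in11/dF [].
have [t] := MVT y0 dF' cF.
rewrite in_itv/= => /andP[t0 ty].
rewrite {2}/F mf_field0 expr0n/= mulr0 addr0 !subr0 /F /mf_field mul1r addr0 => E.
have t21 : 0 < 1 - t ^+ 2 by nra.
have Et : 1 - (1 - t ^+ 2)^-1 + t ^+ 2 = - (t ^+ 4 / (1 - t ^+ 2)).
  by field; rewrite gt_eqF.
rewrite Et in E.
have q0 : 0 <= t ^+ 4 / (1 - t ^+ 2) by rewrite divr_ge0 ?exprn_ge0// ltW.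
split=> [|y2].
  have : 0 <= t ^+ 4 / (1 - t ^+ 2) * y by rewrite mulr_ge0// ltW.
  by move: E; rewrite mulNr; lra.
have q1 : t ^+ 4 / (1 - t ^+ 2) <= 2 * y ^+ 4.
  rewrite ler_pdivrMr//; apply: (@le_trans _ _ (y ^+ 4)).
    by rewrite lerXn2r ?nnegrE// ltW.
  rewrite mulrAC ler_peMl ?exprn_ge0 ?(ltW y0)//; nra.
have : t ^+ 4 / (1 - t ^+ 2) * y <= 2 * y ^+ 4 * y by rewrite ler_pM2r.
have -> : 2 * y ^+ 4 * y = 2 * y ^+ 5 by rewrite -mulrA -exprSr.
by move: E; rewrite mulNr; lra.
Qed.

Lemma mf_field_critical_le y : 0 <= y < 1 -> mf_field 1 0 y <= - 3^-1 * y ^+ 3.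
Proof.
move=> /andP[y0 y1]; have [+ _] := artanh_cubic _ y0 y1.
by rewrite /mf_field; lra.
Qed.

Lemma mf_field_critical_local (eps : R) : 0 < eps -> exists2 delta, 0 < delta &
  forall x, 0 <= x <= delta -> `|mf_field 1 0 x + 3^-1 * x ^+ 3| <= eps * x ^+ 3.
Proof.
move=> e0; exists (Num.min 2^-1 (eps / 2)).
  by rewrite lt_min divr_gt0// andbT.
move=> x /andP[x0]; rewrite le_min => /andP[x2 xe].
have x1 : x < 1 by lra.
have [lo /(_ x2) hi] := artanh_cubic _ x0 x1.
have x5 : 2 * x ^+ 5 <= eps * x ^+ 3.
  have -> : 2 * x ^+ 5 = (2 * x ^+ 2) * x ^+ 3 by rewrite -mulrA -exprD.
  by rewrite ler_wpM2r ?exprn_ge0//; nra.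
rewrite ler_norml /mf_field; apply/andP; split; lra.
Qed.

End Critical.

(** * Ratios of consecutive level weights *)

Section LevelRatios.
Context {R : realType} (b h : R).
Local Notation g := (mf_field b h).
Local Notation w := (level_weight b h).

(** The magnetisation halfway between levels [k] and [k + 1], normalised by
    [n + 1] instead of [n]: this makes [level_weight_step] exact. *)
Definition midpoint (n k : nat) : R := (2 * k%:R + 1 - n%:R) / n.+1%:R.

Definition log_ratio (n k : nat) : R :=
  2 * g (midpoint n k) + 2 * b * midpoint n k / n%:R.

Lemma level_weight_gt0 n k : (k <= n)%N -> 0 < w n k.
Proof. by move=> kn; rewrite mulr_gt0 ?expR_gt0// ltr0n bin_gt0. Qed.

Lemma midpointM n k : n.+1%:R * midpoint n k = 2 * k%:R + 1 - n%:R.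
Proof. by rewrite /midpoint mulrC divfK// pnatr_eq0. Qed.

Lemma midpoint_itv n k : (k < n)%N -> -1 < midpoint n k < 1.
Proof.
move=> kn; have kn' : k%:R + 1 <= n%:R :> R by rewrite natr1 ler_nat.
have k0 : 0 <= k%:R :> R by [].
rewrite /midpoint ltr_pdivlMr ?ltr0Sn// ltr_pdivrMr ?ltr0Sn//.
by rewrite -natr1; lra.
Qed.

(** The quotient ['C(n, k.+1) / 'C(n, k) = (n - k) / k.+1] equals
    [(1 - y) / (1 + y) = expR (- (2 * artanh y))] at [y = midpoint n k]. *)
Lemma level_weight_step n k : (k < n)%N -> w n k.+1 = w n k * expR (log_ratio n k).
Proof.
move=> kn; have y1 := midpoint_itv _ _ kn.
have n0 : (n%:R : R) != 0 by rewrite pnatr_eq0 -lt0n (leq_ltn_trans _ kn).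
have n1 : (n.+1%:R : R) != 0 by rewrite pnatr_eq0.
have k1 : (k.+1%:R : R) != 0 by rewrite pnatr_eq0.
have nk : (n%:R - k%:R : R) != 0 by rewrite subr_eq0 eqr_nat gtn_eqF.
have -> : log_ratio n k = - (2 * artanh (midpoint n k)) +
    (2 * b * midpoint n k * (n.+1%:R / n%:R) + 2 * h).
  rewrite /log_ratio /mf_field -[n.+1]addn1 natrD; field; exact: n0.
rewrite expRD [expR (- _)]expRN expR_2artanh// /level_weight.
have -> : ((1 + midpoint n k) / (1 - midpoint n k))^-1 = (n%:R - k%:R) / k.+1%:R.
  have -> : 1 + midpoint n k = 2 * k.+1%:R / n.+1%:R.
    rewrite /midpoint -[k.+1]addn1 natrD; apply: (mulIf n1).
    by rewrite mulrDl !divfK// -natr1; ring.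
  have -> : 1 - midpoint n k = 2 * (n%:R - k%:R) / n.+1%:R.
    rewrite /midpoint; apply: (mulIf n1).
    by rewrite mulrBl !divfK// -natr1; ring.
  move: (n.+1%:R) (k.+1%:R) (n%:R - k%:R) n1 k1 nk => N1 K1 NK n1 k1 nk.
  by field; rewrite n1 nk k1.
have -> : 'C(n, k.+1)%:R = 'C(n, k)%:R * ((n%:R - k%:R) / k.+1%:R) :> R.
  have /(congr1 (fun m => m%:R : R)) := mul_bin_left n k.
  rewrite !natrM natrB 1?ltnW// => H; apply: (mulfI k1); rewrite H.
  by move: (k.+1%:R) k1 => K1 k1; field.
rewrite [RHS]mulrACA; congr (_ * _); rewrite -expRD; congr expR.
rewrite /midpoint -[k.+1]addn1 natrD; field; exact/andP.
Qed.

Lemma level_weight_right n k m : (k + m <= n)%N ->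
  w n (k + m) = w n k * expR (\sum_(j < m) log_ratio n (k + j)).
Proof.
elim: m => [|m IH] kmn; first by rewrite big_ord0 expR0 mulr1 addn0.
rewrite addnS level_weight_step -?addnS// IH ?(leq_trans _ kmn) ?addnS//.
by rewrite big_ord_recr/= [in RHS]expRD mulrA.
Qed.

Lemma level_weight_left n k m : (m <= k)%N -> (k <= n)%N ->
  w n (k - m) = w n k * expR (\sum_(j < m) - log_ratio n (k - j.+1)).
Proof.
move=> + kn; elim: m => [|m IH] mk; first by rewrite big_ord0 expR0 mulr1 subn0.
rewrite big_ord_recr/= expRD mulrA -IH 1?ltnW// expRN.
have -> : (k - m = (k - m.+1).+1)%N by rewrite subnSK.
rewrite level_weight_step ?mulfK ?gt_eqF ?expR_gt0//.
by rewrite subnSK// (leq_trans (leq_subr _ _)).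
Qed.

(** The weight of level [n - k] relative to that of level [k]. *)
Definition flip_ratio (n k : nat) : R := expR (- (2 * h) * (2 * k%:R - n%:R)).

Lemma level_weight_flip n k : (k <= n)%N -> w n (n - k) = w n k * flip_ratio n k.
Proof.
move=> kn; rewrite /level_weight /flip_ratio bin_sub// -[RHS]mulrA -expRD natrB//.
by congr (_ * expR _); ring.
Qed.

Lemma flip_ratio_itv n k : 0 <= h -> (n <= k.*2)%N -> 0 <= flip_ratio n k <= 1.
Proof.
move=> h0 nk; rewrite expR_ge0/= -expR0 ler_expR mulNr oppr_le0 !mulr_ge0//.
by rewrite subr_ge0 -natrM mul2n ler_nat.
Qed.

(** Each level below the middle is read as the mirror image of one above it;
    when [n] is even the central level is its own mirror image and would be
    counted twice. *)
Lemma sum_level_weight_fold n :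
  \sum_(k < n.+1) w n k =
  \sum_(uphalf n <= k < n.+1) w n k * (1 + flip_ratio n k)
    - (if odd n then 0 else w n (uphalf n)).
Proof.
have un : (uphalf n <= n.+1)%N by lia.
rewrite [LHS](bigID (fun k : 'I_n.+1 => (n <= k.*2)%N))/=.
rewrite [X in _ + X](reindex_inj rev_ord_inj)/=.
have -> : \sum_(k < n.+1 | ~~ (n <= (n.+1 - k.+1).*2)%N) w n (n.+1 - k.+1) =
    \sum_(k < n.+1 | (n < k.*2)%N) w n k * flip_ratio n k.
  apply: eq_big => k; first by have := ltn_ord k; lia.
  by move=> _; rewrite subSS level_weight_flip// -ltnS.
have low (P : pred nat) (F : nat -> R) : (forall k, (uphalf n <= k < n.+1)%N -> P k) ->
    (forall k, P k -> (uphalf n <= k)%N) ->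
    \sum_(k < n.+1 | P k) F k = \sum_(uphalf n <= k < n.+1) F k.
  move=> P1 P2; rewrite -(big_mkord P F) (@big_cat_nat _ _ _ (uphalf n))//=.
  rewrite big_nat_cond big1 ?add0r.
    rewrite big_nat_cond [RHS]big_nat; apply: eq_bigl => k.
    by case: (boolP (_ <= k < _)%N) => //= /P1 ->.
  by move=> k /andP[/andP[_ ku] /P2]; rewrite leqNgt ku.
rewrite (low (fun k => n <= k.*2)%N); [|lia|lia].
under [in RHS]eq_bigr do rewrite mulrDr mulr1.
rewrite big_split/= -addrA; congr (_ + _).
case: ifPn => [on|en].
  rewrite subr0.
  by apply: (low (fun k => n < k.*2)%N (fun k => w n k * flip_ratio n k)) => k; lia.
have u0 : (uphalf n < n.+1)%N by lia.
rewrite [in RHS]big_ltn//.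
have -> : flip_ratio n (uphalf n) = 1.
  rewrite /flip_ratio (_ : 2 * _ - _ = 0) ?mulr0 ?expR0//.
  apply/eqP; rewrite subr_eq0 -natrM eqr_nat; apply/eqP.
  by rewrite mul2n -[RHS]odd_double_half; lia.
rewrite mulr1 addrAC subrr add0r.
rewrite -(big_mkord (fun k => n < k.*2)%N (fun k => w n k * flip_ratio n k)).
rewrite (@big_cat_nat _ _ _ (uphalf n).+1)//=.
rewrite big_nat_cond big1 ?add0r.
  rewrite big_nat_cond [RHS]big_nat; apply: eq_bigl => k.
  by case: (boolP (_ < k < _)%N) => //= H; lia.
by move=> k H; lia.
Qed.

Lemma sum_split_at (F : nat -> R) c k n : (c <= k)%N -> (k <= n)%N ->
  \sum_(c <= i < n.+1) F i =
  \sum_(m < (n - k).+1) F (k + m)%N + \sum_(m < (k - c).+1) F (k - m)%N - F k.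
Proof.
move=> ck kn; rewrite (@big_cat_nat _ _ _ k)//=; last exact: leqW.
rewrite addrC -addrA; congr (_ + _).
  rewrite -{1}[k]add0n big_addn subSn// big_mkord.
  by apply: eq_bigr => m _; rewrite addnC.
rewrite [X in _ = X - _]big_ord_recl/= subn0 [F k + _]addrC addrK.
rewrite big_nat_rev/= -{1}[c]add0n big_addn big_mkord.
by apply: eq_bigr => m _; congr F; rewrite /bump/=; have := ltn_ord m; lia.
Qed.

End LevelRatios.

Section ReferenceLevel.
Context {R : realType} (z : R) (z0 : 0 <= z) (z1 : z < 1).

(** The first [k] with [midpoint n k > z]: since [g] changes sign at [z], the
    level weights peak there up to a factor tending to 1. *)
Definition ref_level (n : nat) : nat := Num.truncn (n.+1%:R * (1 + z) / 2).
Local Notation k0 := ref_level.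

Lemma ref_level_bounds n :
  2 * (k0 n)%:R <= n.+1%:R * (1 + z) < 2 * (k0 n)%:R + 2.
Proof.
have /truncn_itv/andP[lo hi] : 0 <= n.+1%:R * (1 + z) / 2.
  by rewrite divr_ge0// mulr_ge0//; have := z0; lra.
rewrite -/(k0 n) in lo hi; rewrite -natr1 in hi; lra.
Qed.

Lemma ref_level_le n : (k0 n <= n)%N.
Proof.
rewrite -ltnS -(ltr_nat R); have /andP[lo _] := ref_level_bounds n.
have : n.+1%:R * (1 + z) < n.+1%:R * 2.
  by rewrite ltr_pM2l ?ltr0Sn//; have := z1; lra.
by lra.
Qed.

Lemma ref_level_ge n : (uphalf n <= k0 n)%N.
Proof.
suff : (n.+1 < (k0 n).*2.+2)%N by lia.
rewrite -(ltr_nat R); have /andP[_ hi] := ref_level_bounds n.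
rewrite -addn2 natrD -mul2n natrM; apply: le_lt_trans hi.
by rewrite ler_peMr//; have := z0; lra.
Qed.

Lemma midpoint_ref n : 0 < n.+1%:R * (midpoint n (k0 n) - z) <= 2.
Proof.
rewrite mulrBr midpointM; have := ref_level_bounds n.
by rewrite mulrDr mulr1 -natr1 => /andP[lo hi]; apply/andP; split; lra.
Qed.

Lemma ref_level0 n : z = 0 -> k0 n = uphalf n.
Proof.
move=> zE; apply/eqP; rewrite eqn_leq ref_level_ge andbT.
have /andP[lo _] := ref_level_bounds n; move: lo; rewrite zE addr0 mulr1.
by rewrite -natrM ler_nat; lia.
Qed.

End ReferenceLevel.

(** * Riemann sums and the two limiting integrals *)

Section RiemannSum.
Context {R : realType}.
Local Notation mu := (@lebesgue_measure R).
Local Notation Rpos := (`[0%R, +oo[%classic : set R).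

Definition step_fun (s : R) (N : nat) (a : nat -> R) (t : R) : R :=
  \sum_(m < N) a m * \1_(`[m%:R / s, m.+1%:R / s[%classic) t.

Lemma step_funE (s : R) N a t : 0 < s -> 0 <= t ->
  step_fun s N a t = if (Num.truncn (t * s) < N)%N then a (Num.truncn (t * s)) else 0.
Proof.
move=> s0 t0.
have cell m : \1_(`[m%:R / s, m.+1%:R / s[%classic) t
    = (Num.truncn (t * s) == m)%:R :> R.
  rewrite truncn_eq ?mulr_ge0 ?(ltW s0)// -ler_pdivrMr// -ltr_pdivlMr//.
  by rewrite indicE/= mem_setE in_itv.
rewrite /step_fun; case: ifPn => [tN|]; last first.
  rewrite -leqNgt => Nt; apply: big1 => m _; rewrite cell.
  by rewrite gtn_eqF ?mulr0// (leq_trans (ltn_ord m)).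
rewrite (bigD1 (Ordinal tN))//= cell eqxx mulr1 big1 ?addr0// => m mN.
rewrite cell; case: eqP => [E|]; last by rewrite mulr0.
by move: mN; rewrite -val_eqE/= E eqxx.
Qed.

Lemma measurable_step_fun s N a (D : set R) : measurable_fun D (step_fun s N a).
Proof.
by apply: measurable_sum => m; apply: measurable_funM.
Qed.

Lemma integral_step_fun s N a : 0 < s -> (forall m, (m < N)%N -> 0 <= a m) ->
  (\int[mu]_(t in `[0%R, +oo[) (step_fun s N a t)%:E)%E =
  (s^-1 * \sum_(m < N) a m)%:E.
Proof.
move=> s0 a0; rewrite /step_fun.
under eq_integral do rewrite -sumEFin.
have mI m : measurable_fun Rpos
    (EFin \o (\1_(`[m%:R / s, m.+1%:R / s[%classic) : R -> R)).
  by apply/measurable_EFinP/measurable_indic; exact: measurable_itv.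
have mf (m : 'I_N) : measurable_fun Rpos
    (fun t : R => (a m * \1_(`[m%:R / s, m.+1%:R / s[%classic) t)%:E).
  apply/measurable_EFinP; exact: measurable_funM.
rewrite ge0_integral_sum//; last first.
  by move=> m t _; rewrite lee_fin mulr_ge0// a0.
rewrite mulr_sumr -sumEFin; apply: eq_bigr => m _.
under eq_integral do rewrite EFinM.
rewrite ge0_integralZl//; last first.
- by rewrite lee_fin a0.
- exact: mI.
rewrite integral_indic//.
have -> : `[m%:R / s, m.+1%:R / s[%classic `&` `[0%R, +oo[%classic =
    `[m%:R / s, m.+1%:R / s[%classic :> set R.
  rewrite setIidl// => t /=; rewrite !in_itv/= andbT => /andP[+ _].
  by apply: le_trans; rewrite divr_ge0// ltW.
transitivity ((a m)%:E * (s^-1)%:E)%E; last by rewrite -EFinM mulrC.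
congr (_ * _)%E; etransitivity; first exact: lebesgue_measure_itv.
rewrite /= lte_fin ltr_pM2r ?invr_gt0// ltr_nat ltnSn.
by rewrite -EFinB -mulrBl -natrB// subSnn mul1r.
Qed.

Lemma integrable_expRN (g C : R) : 0 < g ->
  mu.-integrable `[0%R, +oo[ (fun t => (C * expR (- g * t))%:E).
Proof.
move=> g0.
have mRpos : measurable Rpos by exact: measurable_itv.
have := @integrableS _ _ R mu _ _ _ measurableT mRpos (@subsetT _ _)
  (integrable_exponential_pdf g0).
move=> /(@integrableZl _ _ R mu _ mRpos (C / g) _).
apply: eq_integrable => //= t; rewrite inE/= in_itv/= andbT => t0.
by rewrite exponential_pdfE// -EFinM mulrA divfK// gt_eqF.
Qed.

(** Seen through step functions of mesh [1 / s n], this is dominated convergence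
    with an exponential majorant. *)
Lemma cvg_riemann_sum (s : nat -> R) (N : nat -> nat) (f : nat -> nat -> R)
    (phi : R -> R) (C g : R) :
  0 < g -> s n @[n --> \oo] --> +oo -> (N n)%:R / s n @[n --> \oo] --> +oo ->
  (\forall n \near \oo, forall m, (m < N n)%N ->
     0 <= f n m <= C * expR (- g * (m%:R / s n))) ->
  measurable_fun Rpos phi ->
  (forall t, 0 <= t -> f n (Num.truncn (t * s n)) @[n --> \oo] --> phi t) ->
  (s n)^-1 * \sum_(m < N n) f n m @[n --> \oo] -->
    Rintegral mu `[0%R, +oo[ phi.
Proof.
move=> g0 sy Ny fb mphi fphi.
have [n0 _ Hn0] : \forall n \near \oo, 1 <= s n /\
    (forall m, (m < N n)%N -> 0 <= f n m <= C * expR (- g * (m%:R / s n))).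
  near=> n; split; last by near: n.
  by near: n; move/cvgryPge: sy; exact.
rewrite -(cvg_shiftn n0).
pose F n t := (step_fun (s (n + n0)) (N (n + n0)) (f (n + n0)) t)%:E.
have s1 n : 1 <= s (n + n0) by have [] := Hn0 (n + n0)%N (leq_addl _ _).
have sp n : 0 < s (n + n0) by apply: lt_le_trans (s1 n).
have fn n m : (m < N (n + n0))%N ->
    0 <= f (n + n0) m <= C * expR (- g * (m%:R / s (n + n0))).
  by have [_] := Hn0 (n + n0)%N (leq_addl _ _); exact.
pose C' := `|C| * expR g.
have Fb n t : 0 <= t -> (`|F n t| <= (C' * expR (- g * t))%:E)%E.
  move=> t0; rewrite /F abse_EFin lee_fin step_funE//.
  have [C0|] := boolP (0 < N (n + n0))%N; last first.
    by rewrite -leqNgt leqn0 => /eqP ->; rewrite normr0 !mulr_ge0// ?expR_ge0.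
  case: ifPn => tN; last by rewrite normr0 !mulr_ge0// ?expR_ge0.
  have /andP[f0 fC] := fn _ _ tN; rewrite ger0_norm//; apply: le_trans fC _.
  rewrite /C' -mulrA -expRD; apply: ler_pM; rewrite ?ler_norm ?expR_ge0//.
    have /andP[f0' fC'] := fn _ _ C0.
    by have := le_trans f0' fC'; rewrite pmulr_lge0// expR_gt0.
  rewrite ler_expR !mulNr -{2}[g]mulr1 -mulrBr -opprB mulrN lerN2.
  rewrite ler_wpM2l ?(ltW g0)// ler_pdivlMr//.
  have := truncnS_gt (t * s (n + n0)); rewrite -[_.+1]addn1 natrD => /ltW.
  have := s1 n; nra.
have mF n : measurable_fun Rpos (F n).
  by apply/measurable_EFinP; exact: measurable_step_fun.
have Fphi t : 0 <= t -> F n t @[n --> \oo] --> (phi t)%:E.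
  move=> t0; apply: cvg_EFin; first by near=> n.
  have := fphi _ t0; rewrite -(cvg_shiftn n0); apply: cvg_trans.
  apply: near_eq_cvg; near=> n; rewrite /F /= step_funE// ifT//.
  rewrite truncn_lt_nat ?mulr_ge0 ?(ltW (sp n))// -ltr_pdivlMr//.
  near: n; rewrite near_simpl; move: Ny; rewrite -(cvg_shiftn n0).
  by move=> /cvgryPgt; exact.
have [] := @dominated_convergence _ _ _ mu `[0%R, +oo[ (measurable_itv _) F
  (EFin \o phi) (fun t => (C' * expR (- g * t))%:E) mF.
- exact/measurable_EFinP.
- by apply: aeW => t /=; rewrite in_itv/= andbT => t0; exact: Fphi.
- exact: integrable_expRN.
- by apply: aeW => t n /=; rewrite in_itv/= andbT => t0; exact: Fb.
move=> iphi _ cF.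
have -> : (fun n => (s (n + n0))^-1 * \sum_(m < N (n + n0)) f (n + n0)%N m) =
    fun n => fine (\int[mu]_(t in `[0%R, +oo[) F n t)%E.
  apply/funext => n; rewrite integral_step_fun// => m mN.
  by have /andP[] := fn _ _ mN.
apply: fine_cvg; rewrite fineK//.
exact: (integrable_fin_num _ iphi).
Unshelve. all: by end_near. Qed.

Lemma continuous_measurable_Rpos (f : R -> R) : continuous f -> measurable_fun Rpos f.
Proof. by move=> cf; apply: measurable_funTS; exact: continuous_measurable_fun. Qed.

Lemma is_derive_mulr (a t : R) : is_derive t 1 (fun u => a * u) a.
Proof.
have : is_derive t 1 (cst a * id : R -> R) (cst a t *: 1 + id t *: 0).
  exact: is_deriveM.
by rewrite scaler0 addr0 /GRing.scale/= mulr1.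
Qed.

(** The substitution [u = sqrt c * t] reduces this to the Gauss integral. *)
Lemma Rintegral_gauss (c : R) : 0 < c ->
  Rintegral mu `[0%R, +oo[ (fun t => expR (- c * t ^+ 2)) = Num.sqrt (pi / c) / 2.
Proof.
move=> c0; have sc0 : 0 < Num.sqrt c by rewrite sqrtr_gt0.
have := @increasing_ge0_integration_by_substitutiony R
  (fun t => Num.sqrt c * t) (@gauss_fun R) 0.
have idF (t : R) : is_derive t 1 (fun t => Num.sqrt c * t) (Num.sqrt c).
  exact: is_derive_mulr.
have dF : (fun t => Num.sqrt c * t)^`()%classic = cst (Num.sqrt c).
  by apply/funext => t; rewrite derive1E derive_val.
rewrite dF mulr0 integral0y_gauss => H.
have {H} : (Num.sqrt pi / 2)%:E = (\int[mu]_(x in `[0%R, +oo[)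
    ((Num.sqrt c)%:E * (expR (- c * x ^+ 2))%:E))%E.
  rewrite H.
  - apply: eq_integral => t _; rewrite -EFinM mulrC; congr (_ * _)%:E.
    by rewrite /gauss_fun/= exprMn sqr_sqrtr ?(ltW c0)// mulNr.
  - by move=> x y _ _; rewrite ltr_pM2l.
  - by move=> x _; exact: cvg_cst.
  - exact: is_cvg_cst.
  - exact: is_cvg_cst.
  - split; first by move=> x _; exact: ex_derive.
    apply: cvg_at_right_filter; apply: differentiable_continuous.
    exact/derivable1_diffP/ex_derive.
  - by apply: gt0_cvgMry => //; exact: cvg_id.
  - by apply: continuous_subspaceT => x; exact: continuous_gauss_fun.
  - by move=> x _; exact: gauss_fun_ge0.
have mf : measurable_fun Rpos (fun x : R => expR (- c * x ^+ 2)).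
  apply: continuous_measurable_Rpos => x.
  apply: continuous_comp; last exact: continuous_expR.
  by apply: cvgM; [exact: cvg_cst|exact: exprn_continuous].
rewrite ge0_integralZl//; last exact/measurable_EFinP.
rewrite /Rintegral; case: (integral _ _ _) => [r||].
- rewrite -EFinM => -[H] /=; rewrite sqrtrM ?pi_ge0// sqrtrV.
  apply: (mulfI (lt0r_neq0 sc0)); rewrite -H; field.
    exact: lt0r_neq0.
  exact: ltW.
- by rewrite mulry gtr0_sg// mul1e.
- by rewrite mulrNy gtr0_sg// mul1e.
Qed.

(** Recovers an integral that is singular at 0 from its truncations. *)
Lemma cvg_integral_itvoy (a : nat -> R) (f : R -> R) :
  (forall n, 0 < a n) -> {homo a : m n / (m <= n)%N >-> n <= m} ->
  a n @[n --> \oo] --> 0 -> measurable_fun (`]0%R, +oo[%classic : set R) f ->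
  (forall x, 0 < x -> 0 <= f x) ->
  (\int[mu]_(x in `[a n, +oo[) (f x)%:E)%E @[n --> \oo] -->
  (\int[mu]_(x in `]0%R, +oo[) (f x)%:E)%E.
Proof.
move=> a0 adec acvg mf f0.
have -> : `]0%R, +oo[%classic = \bigcup_n `[a n, +oo[%classic :> set R.
  apply/seteqP; split => x /=; rewrite in_itv/= andbT.
    move=> x0; have [n _ /(_ n (leqnn _))] : \forall n \near \oo, a n < x.
      by move/cvgr_lt: acvg; apply.
    by move=> anx; exists n => //=; rewrite in_itv/= andbT ltW.
  by move=> [n _] /=; rewrite in_itv/= andbT; exact: lt_le_trans.
apply: ge0_nondecreasing_set_cvg_integral.
- move=> m n mn; apply/subsetPset => x /=; rewrite !in_itv/= !andbT.
  by apply: le_trans; exact: adec.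
- by move=> i; exact: measurable_itv.
- move=> i; apply/measurable_EFinP; apply: measurable_funS mf => //.
  by move=> x /=; rewrite !in_itv/= !andbT; exact: lt_le_trans.
- move=> i x /=; rewrite in_itv/= andbT lee_fin => ax; apply: f0.
  exact: lt_le_trans ax.
Qed.

Lemma cvg_powRy (r : R) : 0 < r -> x `^ r @[x --> +oo] --> +oo.
Proof.
move=> r0; apply/cvgryPge => A; near=> x.
apply: (@le_trans _ _ (Num.max A 0)); first by rewrite le_max lexx.
have -> : Num.max A 0 = (Num.max A 0 `^ r^-1) `^ r.
  by rewrite -powRrM mulVf ?gt_eqF// powRr1// le_max lexx orbT.
by apply: ge0_ler_powR; rewrite ?nnegrE ?powR_ge0 ?(ltW r0)//;
  near: x; exact: nbhs_pinfty_ge.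
Unshelve. all: by end_near. Qed.

Lemma continuous_powR (r x : R) : 0 < x -> {for x, continuous (@powR R ^~ r)}.
Proof.
move=> x0; apply: differentiable_continuous; apply/derivable1_diffP.
by have [] := is_derive1_powR r x0.
Qed.

(** Integrability comes from [t <= 1 + t ^+ m.+1], positivity from the mass of
    [[0, 1]]. *)
Lemma Rintegral_expRNX_gt0 (c : R) m : 0 < c ->
  0 < Rintegral mu `[0%R, +oo[ (fun t => expR (- c * t ^+ m.+1)).
Proof.
move=> c0; pose f (t : R) := expR (- c * t ^+ m.+1).
have cf : continuous f.
  move=> x; apply: continuous_comp; last exact: continuous_expR.
  by apply: cvgM; [exact: cvg_cst|exact: exprn_continuous].
have mf (D : set R) : measurable_fun D (EFin \o f).
  apply/measurable_EFinP; apply: measurable_funTS.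
  exact: continuous_measurable_fun.
have mRpos : measurable Rpos by exact: measurable_itv.
have fi : mu.-integrable Rpos (EFin \o f).
  apply: (@le_integrable _ _ R mu Rpos mRpos (EFin \o f) (fun t => (expR c * expR (- c * t))%:E)
    (mf _) _ (integrable_expRN c (expR c) c0)).
  move=> t /=; rewrite in_itv/= andbT => t0; rewrite lee_fin !ger0_norm ?mulr_ge0 ?expR_ge0//.
  rewrite -expRD ler_expR -subr_ge0.
  have -> : c + - c * t - - c * t ^+ m.+1 = c * (1 - t + t ^+ m.+1) by ring.
  rewrite mulr_ge0 ?(ltW c0)//; have [t1|t1] := leP t 1.
    by rewrite addr_ge0 ?subr_ge0// exprn_ge0.
  have : t <= t ^+ m.+1 by rewrite exprS ler_peMr// exprn_ege1// ltW.
  by lra.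
have lb : ((expR (- c))%:E <= \int[mu]_(t in `[0%R, +oo[) (f t)%:E)%E.
  have m01 : measurable (`[0%R, 1%R]%classic : set R) by exact: measurable_itv.
  apply: (@le_trans _ _ (\int[mu]_(t in `[0%R, 1%R]) (cst (expR (- c))%:E t))%E).
    rewrite integral_cst//= lebesgue_measure_itv/= lte_fin ltr01.
    by rewrite sube0 mule1.
  apply: (@le_trans _ _ (\int[mu]_(t in `[0%R, 1%R]) (f t)%:E)%E).
    apply: ge0_le_integral => //; try by move=> x _; rewrite lee_fin expR_ge0.
      exact: mf.
    move=> t /=; rewrite in_itv/= => /andP[t0 t1]; rewrite lee_fin ler_expR.
    by rewrite mulNr lerN2 ler_piMr ?(ltW c0)// exprn_ile1.
  apply: ge0_subset_integral => //; try by move=> x _; rewrite lee_fin expR_ge0.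
    exact: mf.
  by move=> t /=; rewrite !in_itv/= => /andP[->].
rewrite /Rintegral; apply: fine_gt0; rewrite (lt_le_trans _ lb) ?lte_fin ?expR_gt0//=.
by have := @integrable_fin_num _ _ R mu Rpos mRpos _ fi; rewrite ge0_fin_numE//;
  apply: integral_ge0 => x _; rewrite lee_fin expR_ge0.
Qed.

(** The substitution [t = c u ^ 4], read in the direction [u = (t / c) ^ (1 / 4)]
    so that its derivative has a limit at infinity, and on [[a, +oo[] with [a > 0]
    because that derivative blows up at the origin. *)
Lemma Rintegral_quartic (c : R) : 0 < c ->
  Rintegral mu `[0%R, +oo[ (fun t => expR (- c * t ^+ 4)) =
  c `^ (- (1 / 4)) / 4 * Gamma (1 / 4).
Proof.
move=> c0; pose k := c `^ (- (1 / 4)); have k0 : 0 < k by rewrite powR_gt0.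
pose F t := k * t `^ (1 / 4).
pose G u := expR (- c * u ^+ 4).
have powR4 (x : R) : 0 <= x -> (x `^ (1 / 4)) ^+ 4 = x.
  move=> x0; rewrite -powR_mulrn ?powR_ge0// -powRrM div1r mulVf ?powRr1//.
have k4 : k ^+ 4 = c^-1.
  rewrite /k -powR_mulrn ?powR_ge0// -powRrM.
  have -> : - (1 / 4) * 4%:R = -1 :> R by field.
  by rewrite powR_inv1 // ltW.
have GF t : 0 <= t -> G (F t) = expR (- t).
  move=> t0; rewrite /G /F exprMn k4 powR4//; congr expR.
  by rewrite mulrA mulNr divff ?mulN1r// gt_eqF.
have cG : continuous G.
  move=> x; apply: continuous_comp; last exact: continuous_expR.
  by apply: cvgM; [exact: cvg_cst|exact: exprn_continuous].
have dF (t : R) : 0 < t -> is_derive t 1 F (k * (1 / 4 * t `^ (1 / 4 - 1))).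
  move=> t0; have dP := is_derive1_powR (1 / 4) t0.
  have : is_derive t 1 (cst k * (@powR R ^~ (1 / 4)) : R -> R)
     (cst k t *: (1 / 4 * t `^ (1 / 4 - 1)) + t `^ (1 / 4) *: 0).
    exact: is_deriveM.
  by rewrite scaler0 addr0.
have F'E (t : R) : 0 < t -> F^`()%classic t = k * (1 / 4 * t `^ (1 / 4 - 1)).
  by move=> t0; rewrite derive1E; have Dt := dF t t0; rewrite derive_val.
pose F' t := k * (1 / 4 * t `^ (1 / 4 - 1)).
have cF' (t : R) : 0 < t -> {for t, continuous F'}.
  move=> t0; apply: cvgM; first exact: cvg_cst.
  apply: cvgM; first exact: cvg_cst.
  exact: continuous_powR.
have subst (a : R) : 0 < a -> (\int[mu]_(x in `[F a, +oo[) (G x)%:E =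
    \int[mu]_(x in `[a, +oo[) ((k / 4)%:E *
      (x `^ (1 / 4 - 1) * expR (- x))%:E))%E.
  move=> a0; rewrite (@increasing_ge0_integration_by_substitutiony R F G a).
  - apply: eq_integral => t; rewrite inE/= in_itv/= andbT => at0.
    have t0 : 0 < t by exact: lt_le_trans at0.
    rewrite -EFinM; congr EFin; rewrite -[LHS]/(G (F t) * F^`()%classic t).
    by rewrite F'E// GF ?(ltW t0)//; field.
  - move=> x y; rewrite !in_itv/= !andbT => ax ay xy.
    rewrite ltr_pM2l// gt0_ltr_powR// nnegrE ltW//.
      exact: lt_le_trans ax.
    exact: lt_le_trans ay.
  - move=> x; rewrite in_itv/= andbT => ax.
    have x0 : 0 < x by exact: lt_trans ax.
    rewrite /continuous_at F'E//; apply: cvg_trans (cF' x x0).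
    apply: near_eq_cvg; near=> y; rewrite F'E//; near: y.
    exact: lt_nbhsr.
  - apply/cvg_ex; exists (F' a).
    apply: cvg_at_right_filter; apply: cvg_trans (cF' a a0).
    apply: near_eq_cvg; near=> y; rewrite F'E//; near: y.
    exact: lt_nbhsr.
  - apply/cvg_ex; exists (k * (1 / 4 * 0)).
    apply: (@cvg_trans _ (F' x @[x --> +oo])).
      by apply: near_eq_cvg; near=> y; rewrite F'E.
    apply: cvgM; first exact: cvg_cst.
    apply: cvgM; first exact: cvg_cst.
    have -> : (fun x : R => x `^ (1 / 4 - 1)) = (fun x => (x `^ (3 / 4))^-1).
      by apply/funext => x; rewrite -powRN; congr (_ `^ _); field.
    apply/gtr0_cvgV0; last by apply: cvg_powRy; lra.
    by near=> y; rewrite powR_gt0.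
  - split.
      move=> x; rewrite in_itv/= andbT => ax.
      by have x0 : 0 < x by [exact: lt_trans ax]; have [] := dF x x0.
    apply: cvg_at_right_filter; apply: differentiable_continuous.
    by apply/derivable1_diffP; have [] := dF a a0.
  - by apply: gt0_cvgMry => //; apply: cvg_powRy; lra.
  - by apply: continuous_subspaceT => x; exact: cG.
  - by move=> x _; exact: expR_ge0.
pose f x := k / 4 * (x `^ (1 / 4 - 1) * expR (- x)).
pose a n : R := (@harmonic R n) ^+ 4.
have a0 n : 0 < a n by rewrite exprn_gt0// harmonic_gt0.
have hle : {homo (@harmonic R) : m n / (m <= n)%N >-> n <= m}.
  by move=> m n mn; rewrite /harmonic /= lef_pV2 ?posrE// ler_nat ltnS.
have Fa n : F (a n) = k * harmonic n.
  rewrite /F /a -powR_mulrn ?harmonic_ge0// -powRrM div1r mulfV ?powRr1//.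
  exact: harmonic_ge0.
have mf0 : measurable_fun (`]0%R, +oo[%classic : set R)
    (fun x => x `^ (1 / 4 - 1) * expR (- x)).
  apply: measurable_funM.
    by apply: measurable_funTS; exact: measurable_powR.
  apply: measurable_funTS; apply: measurableT_comp => //.
have mG : measurable_fun (`]0%R, +oo[%classic : set R) G.
  by apply: measurable_funTS; exact: continuous_measurable_fun.
have Lf : (\int[mu]_(x in `[a n, +oo[) (f x)%:E)%E @[n --> \oo] -->
    (\int[mu]_(x in `]0%R, +oo[) (f x)%:E)%E.
  apply: cvg_integral_itvoy => //.
  - move=> m n mn; rewrite /a lerXn2r ?nnegrE ?harmonic_ge0//.
    exact: hle.
  - rewrite -[0](expr0n R 4).
    apply: (@continuous_cvg _ _ _ _ _ _ (fun x : R => x ^+ 4)).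
      exact: exprn_continuous.
    exact: cvg_harmonic.
  - exact: measurable_funM.
  - by move=> x _; rewrite !mulr_ge0 ?expR_ge0 ?powR_ge0 ?invr_ge0// ltW.
have LG : (\int[mu]_(x in `[a n, +oo[) (f x)%:E)%E @[n --> \oo] -->
    (\int[mu]_(x in `]0%R, +oo[) (G x)%:E)%E.
  rewrite (_ : (fun n => _) = fun n => (\int[mu]_(x in `[F (a n), +oo[) (G x)%:E)%E).
    apply: cvg_integral_itvoy.
    - by move=> n; rewrite Fa mulr_gt0// harmonic_gt0.
    - by move=> m n mn; rewrite !Fa ler_pM2l// hle.
    - rewrite (_ : (fun n => F (a n)) = (fun n => k * harmonic n)).
        rewrite -[X in _ --> X](mulr0 k); apply: cvgM; first exact: cvg_cst.
        exact: cvg_harmonic.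
      exact/funext.
    - exact: mG.
    - by move=> x _; exact: expR_ge0.
  by apply/funext => n; rewrite subst.
have GfE : (\int[mu]_(x in `[0%R, +oo[) (G x)%:E = (k / 4)%:E *
    \int[mu]_(x in `]0%R, +oo[) (x `^ (1 / 4 - 1) * expR (- x))%:E)%E.
  rewrite -ge0_integralZl//.
  - rewrite -integral_itv_obnd_cbnd; first exact: (cvg_unique _ LG Lf).
    exact/measurable_EFinP.
  - exact/measurable_EFinP.
  - by move=> x _; rewrite lee_fin mulr_ge0 ?expR_ge0 ?powR_ge0.
  - by rewrite lee_fin divr_ge0// ltW.
rewrite /Gamma /Rintegral GfE; case: (integral _ _ _) => [r||].
- by rewrite -EFinM.
- by rewrite mulry gtr0_sg ?divr_gt0// mul1e /= mulr0.
- by rewrite mulrNy gtr0_sg ?divr_gt0// mul1e /= mulr0.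
Unshelve. all: by end_near. Qed.

End RiemannSum.

(** * Laplace's method for sums with given log-increments *)

Section PowerSums.
Context {R : realFieldType}.

Lemma subrX_le (x y : R) p : 0 <= y <= x ->
  p.+1%:R * y ^+ p * (x - y) <= x ^+ p.+1 - y ^+ p.+1 <= p.+1%:R * x ^+ p * (x - y).
Proof.
move=> /andP[y0 yx]; have x0 : 0 <= x by exact: le_trans yx.
have S a : p.+1%:R * a = \sum_(i < p.+1) a :> R.
  by rewrite sumr_const card_ord mulr_natl.
rewrite subrXX [p.+1%:R * y ^+ p * _]mulrC [p.+1%:R * x ^+ p * _]mulrC.
apply/andP; split; rewrite ler_wpM2l ?subr_ge0// S;
  apply: ler_sum => i _; have ip : (i <= p)%N by rewrite -ltnS.
  rewrite /= -{1}(subnK ip) exprD ler_wpM2r ?exprn_ge0//.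
  by rewrite lerXn2r// ?nnegrE.
rewrite /= -[X in _ <= x ^+ X](subnK ip) exprD ler_wpM2l ?exprn_ge0//.
by rewrite lerXn2r// ?nnegrE.
Qed.

Lemma distrX_le (x y K : R) p : 0 <= x <= K -> 0 <= y <= K ->
  `|x ^+ p.+1 - y ^+ p.+1| <= p.+1%:R * K ^+ p * `|x - y|.
Proof.
wlog yx : x y / y <= x => [H|] xK yK.
  have [|/ltW] := leP y x; first by move=> ?; exact: H.
  by move=> ?; rewrite distrC [`|x - y|]distrC; exact: H.
have /andP[x0 xK'] := xK; have /andP[y0 yK'] := yK.
have := @subrX_le x y p; rewrite y0 yx => /(_ isT) /andP[lo hi].
rewrite !ger0_norm ?subr_ge0 ?lerXn2r ?nnegrE//.
apply: le_trans hi _; rewrite ler_wpM2r ?subr_ge0// ler_wpM2l ?ler0n//.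
by rewrite lerXn2r// nnegrE (le_trans x0).
Qed.

Lemma sum_natX_bounds p m : let S : R := \sum_(j < m) j%:R ^+ p in
  p.+1%:R * S <= m%:R ^+ p.+1 <= p.+1%:R * (S + m%:R ^+ p).
Proof.
have step (j : nat) : (p.+1%:R * j%:R ^+ p : R) <= (j.+1%:R ^+ p.+1 - j%:R ^+ p.+1 : R)
    <= p.+1%:R * j.+1%:R ^+ p.
  have := @subrX_le j.+1%:R j%:R p; rewrite ler0n ler_nat leqnSn => /(_ isT).
  by rewrite -natrB// subSnn !mulr1.
elim: m => [|m /= /andP[IH1 IH2]] /=.
  by rewrite big_ord0 mulr0 exprS mul0r lexx/= add0r mulr_ge0// exprn_ge0.
rewrite big_ord_recr/=; have /andP[s1 s2] := step m.
have m0 : 0 <= m%:R ^+ p :> R by rewrite exprn_ge0.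
have p0 : 0 <= p.+1%:R :> R by [].
apply/andP; split; first by rewrite mulrDr; lra.
by rewrite mulrDr mulrDr; move: IH2; rewrite mulrDr; lra.
Qed.

Lemma sum_cutoff (D : nat -> R) (x y : R) J M :
  (forall j, (j < M)%N -> D j <= if (j < J)%N then x else y) ->
  forall m, (m <= M)%N ->
  \sum_(j < m) D j <= x * (minn m J)%:R + y * (m - J)%:R.
Proof.
move=> DJ; elim=> [|m IH] mM; first by rewrite big_ord0 min0n sub0n !mulr0 addr0.
rewrite big_ord_recr/=.
have := IH (ltnW mM); have := DJ m mM; case: ltnP => [mJ|Jm].
  have -> : (m - J = 0)%N by apply/eqP; rewrite subn_eq0 ltnW.
  have -> : (m.+1 - J = 0)%N by apply/eqP; rewrite subn_eq0.
  rewrite (minn_idPl mJ).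
  by rewrite -[m.+1]addn1 natrD; lra.
rewrite (minn_idPr (leqW Jm)) subSn// -[(m - J).+1]addn1 natrD; lra.
Qed.

Lemma sum_nonpos_tail (D : nat -> R) M m :
  (forall j, (M <= j)%N -> (j < m)%N -> D j <= 0) ->
  \sum_(j < m) D j <= \sum_(j < minn m M) D j.
Proof.
elim: m => [|m IH] D0; first by rewrite min0n.
have {}IH := IH (fun j Mj jm => D0 j Mj (ltnW jm)).
rewrite big_ord_recr/=; have [mM|Mm] := ltnP m M.
  rewrite (minn_idPl mM) big_ord_recr/= lerD2r.
  by move: IH; rewrite (minn_idPl (ltnW mM)).
rewrite (minn_idPr (leqW Mm)); move: IH; rewrite (minn_idPr Mm) => IH.
by rewrite -[leRHS]addr0 lerD// D0.
Qed.

Lemma decay_arith (x y J m m' s T : R) : m <= 2 * m' + 1 -> J <= T * s + 1 ->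
  x <= J -> m' - J <= y -> 1 <= s -> x - y <= 2 * T * s + 3 * s - m / 2.
Proof. lra. Qed.

End PowerSums.

(** The terms are [expR (\sum_(j < m) D n j)] for [m <= N n], and the increment
    [D n j] is close to [2 * G (v n j)], where [v n j], close to [2 j / n], is the
    distance to the peak and [G x] is equivalent to [- kappa x ^ q] at 0.  With
    [r ^ (q + 1) = n], the scale [s = r ^ q] is the one at which the sum of the
    increments is of order 1, as [s * (s / n) ^ q = 1].
    The bound [G x <= - c x ^ q], which forces the decay of the terms, is asked
    up to the index [M n] only and mere nonpositivity beyond: on the side of the
    peak that faces the origin the field may vanish at the far end.  As [N n] is
    at most about [2 M n], the terms still decay linearly in the exponent. *)
Section LaplaceIncrements.
Context {R : realType} (p : nat) (r : nat -> R) (kappa c C : R) (G : R -> R).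
Context (N M : nat -> nat) (D v : nat -> nat -> R).
Local Notation q := p.+1.
Let s n := r n ^+ q.
Context (ry : r n @[n --> \oo] --> +oo) (rn : forall n, r n ^+ q.+1 = n%:R).
Context (Ns : (N n)%:R / s n @[n --> \oo] --> +oo).
Context (kappa0 : 0 < kappa) (c0 : 0 < c) (C0 : 0 <= C).
Context (Gloc : forall eps, 0 < eps -> exists2 delta, 0 < delta &
   forall x, 0 <= x <= delta -> `|G x + kappa * x ^+ q| <= eps * x ^+ q).
Context (vj : \forall n \near \oo, forall j, (j < N n)%N ->
   0 <= v n j /\ `|n.+1%:R * v n j - 2 * j%:R| <= 2).
Context (DG : \forall n \near \oo, forall j, (j < N n)%N ->
   `|D n j - 2 * G (v n j)| <= C / n%:R).
Context (Gc : \forall n \near \oo, forall j, (j < M n)%N ->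
   G (v n j) <= - c * v n j ^+ q).
Context (D0 : \forall n \near \oo, forall j, (M n <= j < N n)%N -> D n j <= 0).
Context (MN : forall n, (M n <= N n)%N) (NM : forall n, (N n <= (M n).*2.+1)%N).

Lemma near_r1 : \forall n \near \oo, 1 <= r n.
Proof. by move/cvgryPge: ry; exact. Qed.

Lemma near_inv_r (a eps : R) : 0 < eps -> \forall n \near \oo, a / r n <= eps.
Proof.
move=> e0; near=> n.
have r1 : 1 <= r n by near: n; exact: near_r1.
have : a / eps <= r n by near: n; move/cvgryPge: ry; exact.
by rewrite ler_pdivrMr// ler_pdivrMr ?(lt_le_trans _ r1)// mulrC.
Unshelve. all: by end_near. Qed.

Lemma s_ge_r n : 1 <= r n -> r n <= s n.
Proof. by move=> r1; rewrite /s exprS ler_peMr ?(le_trans _ r1)// exprn_ege1. Qed.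

Lemma s_cvgy : s n @[n --> \oo] --> +oo.
Proof.
apply/cvgryPge => A; near=> n; apply: (@le_trans _ _ (r n)).
  by near: n; move/cvgryPge: ry; exact.
by apply: s_ge_r; near: n; exact: near_r1.
Unshelve. all: by end_near. Qed.

Lemma near_lt_N T : \forall n \near \oo, forall j : nat,
  j%:R <= T * s n -> (j < N n)%N.
Proof.
near=> n => j jT; rewrite -(ltr_nat R); apply: le_lt_trans jT _.
have r1 : 1 <= r n by near: n; exact: near_r1.
rewrite -ltr_pdivlMr; last by rewrite exprn_gt0// (lt_le_trans _ r1).
by near: n; move/cvgryPgt: Ns; exact.
Unshelve. all: by end_near. Qed.

(** The scaled increment in the variable [V = r v], for which
    [s v ^ q = V ^ q], is a uniformly small perturbation of a power of [j / s]. *)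
Lemma scaled_increment T eps : 0 < T -> 0 < eps -> \forall n \near \oo,
  forall j : nat, j%:R <= T * s n ->
  `|s n * D n j + 2 ^+ q.+1 * kappa * (j%:R / s n) ^+ q| <= eps.
Proof.
move=> T0 e0; pose K : R := 2 + 2 * T; have K0 : 0 < K by rewrite /K; lra.
pose eps' : R := eps / 6 / (2 * K) ^+ q.
have K2 : 0 < (2 * K) ^+ q by rewrite exprn_gt0// mulr_gt0.
have e0' : 0 < eps' by rewrite /eps' !divr_gt0.
have [delta d0 Gd] := Gloc _ e0'.
pose A : R := 2 * kappa * (q%:R * (2 * K) ^+ p * K).
near=> n => j jT.
have r1 : 1 <= r n by near: n; exact: near_r1.
have r0 : 0 < r n by rewrite (lt_le_trans _ r1).
have s1 : 1 <= s n by rewrite (le_trans r1)// s_ge_r.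
have s0 : 0 < s n by rewrite (lt_le_trans _ s1).
have jN : (j < N n)%N.
  by move: j jT; near: n; exact: near_lt_N.
have [v0 vb] : 0 <= v n j /\ `|n.+1%:R * v n j - 2 * j%:R| <= 2.
  by move: j jN {jT}; near: n.
have Db : `|D n j - 2 * G (v n j)| <= C / n%:R.
  by move: j jN {jT v0 vb}; near: n.
have rsn : r n * s n = n%:R by rewrite /s -exprS rn.
have n0 : 0 < n%:R :> R by rewrite -rsn mulr_gt0.
pose V := r n * v n j; pose W := 2 * (j%:R / s n).
have V0 : 0 <= V by rewrite mulr_ge0// ltW.
have W0 : 0 <= W by rewrite !mulr_ge0// invr_ge0 ltW.
have WT : W <= 2 * T by rewrite ler_pM2l// ler_pdivrMr.
have VW : `|V - W| <= K / s n.
  have -> : V - W = (n%:R / n.+1%:R * (n.+1%:R * v n j - 2 * j%:R)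
     - 2 * j%:R / n.+1%:R) / s n.
    rewrite /V /W -rsn -[n.+1]addn1 natrD -rsn.
    have : r n * s n + 1 != 0 by rewrite gt_eqF// addr_gt0 ?mulr_gt0.
    by move=> h; field; rewrite h gt_eqF.
  rewrite normrM [X in _ * X]gtr0_norm ?invr_gt0// ler_pM2r ?invr_gt0//.
  apply: le_trans (ler_normB _ _) _; rewrite /K lerD//.
    rewrite normrM -[leRHS]mul1r ler_pM// ger0_norm ?divr_ge0//.
    by rewrite ler_pdivrMr ?ltr0Sn// mul1r ler_nat.
  rewrite ger0_norm; last by rewrite divr_ge0// mulr_ge0.
  rewrite -mulrA ler_pM2l// ler_pdivrMr ?ltr0Sn//; apply: le_trans jT _.
  rewrite ler_pM2l// -[n.+1]addn1 natrD -rsn.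
  by apply: (@le_trans _ _ (r n * s n)); [rewrite ler_peMl// ltW|rewrite lerDl].
have VK : V <= 2 * K.
  have := ler_norm (V - W); have : K / s n <= K by rewrite ler_pdivrMr// ler_peMr// ltW.
  by move: VW WT; rewrite /K; lra.
have sv : s n * v n j ^+ q = V ^+ q by rewrite /V exprMn.
have vd : v n j <= delta.
  have -> : v n j = V / r n by rewrite /V mulrAC divff ?mul1r// gt_eqF.
  apply: (@le_trans _ _ (2 * K / r n)); first by rewrite ler_pM2r// invr_gt0.
  by near: n; exact: near_inv_r.
have Gv : `|G (v n j) + kappa * v n j ^+ q| <= eps' * v n j ^+ q.
  by apply: Gd; rewrite v0.
have -> : s n * D n j + 2 ^+ q.+1 * kappa * (j%:R / s n) ^+ q =
    s n * (D n j - 2 * G (v n j)) + 2 * s n * (G (v n j) + kappa * v n j ^+ q)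
    - 2 * kappa * (V ^+ q - W ^+ q).
  rewrite -sv /W [(2 * _) ^+ q]exprMn [2 ^+ q.+1]exprS.
  move: (2 ^+ q) ((_ / _) ^+ q) (v n j ^+ q) (G _) => x1 x2 x3 x4; ring.
have t1 : `|s n * (D n j - 2 * G (v n j))| <= eps / 3.
  rewrite normrM gtr0_norm//; apply: (@le_trans _ _ (s n * (C / n%:R))).
    by rewrite ler_pM2l.
  have -> : s n * (C / n%:R) = C / r n by rewrite -rsn; field; rewrite !gt_eqF.
  by near: n; apply: near_inv_r; lra.
have t2 : `|2 * s n * (G (v n j) + kappa * v n j ^+ q)| <= eps / 3.
  rewrite normrM gtr0_norm ?mulr_gt0//.
  apply: (@le_trans _ _ (2 * s n * (eps' * v n j ^+ q))).
    by rewrite ler_pM2l// mulr_gt0.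
  have -> : 2 * s n * (eps' * v n j ^+ q) = 2 * eps' * V ^+ q by rewrite -sv; ring.
  have -> : eps / 3 = 2 * eps' * (2 * K) ^+ q.
    by rewrite /eps'; field; rewrite gt_eqF.
  rewrite ler_pM2l; last by rewrite mulr_gt0.
  by rewrite lerXn2r// nnegrE mulr_ge0// ltW.
have t3 : `|2 * kappa * (V ^+ q - W ^+ q)| <= eps / 3.
  rewrite normrM gtr0_norm ?mulr_gt0//.
  apply: (@le_trans _ _ (A / r n)); last by near: n; apply: near_inv_r; lra.
  have -> : A / r n = 2 * kappa * (q%:R * (2 * K) ^+ p * (K / r n)).
    by rewrite /A !mulrA.
  rewrite ler_pM2l; last by rewrite mulr_gt0.
  apply: le_trans (@distrX_le _ V W (2 * K) p _ _) _; rewrite ?V0 ?W0//=.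
    by rewrite /K; move: WT; lra.
  rewrite ler_wpM2l//; first by rewrite mulr_ge0// exprn_ge0// mulr_ge0// ltW.
  apply: le_trans VW _; rewrite ler_pM2l// lef_pV2 ?posrE//.
  exact: s_ge_r.
apply: le_trans (ler_normB _ _) _.
have := ler_normD (s n * (D n j - 2 * G (v n j))) (2 * s n * (G (v n j) + kappa * v n j ^+ q)).
by move: t1 t2 t3; lra.
Unshelve. all: by end_near. Qed.

Let c' := 2 ^+ q.+1 * kappa.

Lemma c'_gt0 : 0 < c'. Proof. by rewrite /c' mulr_gt0// exprn_gt0. Qed.

Lemma cvg_truncn_s t : 0 <= t ->
  (Num.truncn (t * s n))%:R / s n @[n --> \oo] --> t.
Proof.
move=> t0; apply/cvgrPdist_le => eps e0; near=> n.
have r1 : 1 <= r n by near: n; exact: near_r1.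
have s0 : 0 < s n by rewrite exprn_gt0// (lt_le_trans _ r1).
have /andP[lo hi] := truncn_itv (mulr_ge0 t0 (ltW s0)).
have -> : t - (Num.truncn (t * s n))%:R / s n =
  (t * s n - (Num.truncn (t * s n))%:R) / s n by field; rewrite gt_eqF.
rewrite ger0_norm ?divr_ge0 ?subr_ge0 ?(ltW s0)//.
apply: (@le_trans _ _ (1 / r n)); last by near: n; exact: near_inv_r.
apply: ler_pM; rewrite ?subr_ge0 ?invr_ge0 ?(ltW s0)//.
  by move: hi; rewrite -[_.+1]addn1 natrD; lra.
by rewrite lef_pV2 ?posrE ?s_ge_r// (lt_le_trans _ r1).
Unshelve. all: by end_near. Qed.

Lemma cvg_sum_power t : 0 <= t ->
  \sum_(j < Num.truncn (t * s n)) (j%:R / s n) ^+ q / s n @[n --> \oo] -->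
  t ^+ q.+1 / q.+1%:R.
Proof.
move=> t0; pose m n := Num.truncn (t * s n).
have mt : (m n)%:R / s n @[n --> \oo] --> t by exact: cvg_truncn_s.
have q0 : (q.+1%:R : R) != 0 by rewrite pnatr_eq0.
have mtq k : ((m n)%:R / s n) ^+ k @[n --> \oo] --> t ^+ k.
  apply: (@continuous_cvg _ _ _ _ _ _ (fun x : R => x ^+ k)) mt.
  exact: exprn_continuous.
apply: (@squeeze_cvgr _ _ _ _ (fun n => ((m n)%:R / s n) ^+ q.+1 / q.+1%:R
    - ((m n)%:R / s n) ^+ q * (s n)^-1) (fun n => ((m n)%:R / s n) ^+ q.+1 / q.+1%:R)).
- near=> n.
  have r1 : 1 <= r n by near: n; exact: near_r1.
  have s0 : 0 < s n by rewrite exprn_gt0// (lt_le_trans _ r1).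
  have -> : \sum_(j < m n) (j%:R / s n) ^+ q / s n =
      (\sum_(j < m n) j%:R ^+ q) * ((s n)^-1) ^+ q.+1.
    by rewrite mulr_suml; apply: eq_bigr => j _; rewrite exprMn [X in _ = _ * X]exprSr mulrA.
  have sq0 : 0 < ((s n)^-1) ^+ q.+1 by rewrite exprn_gt0// invr_gt0.
  have /andP[/= lo hi] := @sum_natX_bounds R q (m n).
  rewrite !exprMn; apply/andP; split.
    have -> : (m n)%:R ^+ q * (s n)^-1 ^+ q / s n =
        (m n)%:R ^+ q * (s n)^-1 ^+ q.+1 by rewrite [(s n)^-1 ^+ q.+1]exprSr mulrA.
    rewrite mulrAC -mulrBl ler_pM2r// lerBlDr ler_pdivrMr ?ltr0Sn//.
    by rewrite mulrC.
  by rewrite mulrAC ler_pM2r// ler_pdivlMr ?ltr0Sn// mulrC.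
- rewrite -[X in _ --> X]subr0 -[X in _ - X](mulr0 (t ^+ q)).
  apply: cvgB; first by apply: cvgM; [exact: mtq|exact: cvg_cst].
  apply: cvgM; first exact: mtq.
  apply/gtr0_cvgV0; last exact: s_cvgy.
  near=> n; rewrite exprn_gt0// (@lt_le_trans _ _ 1)//.
  by near: n; exact: near_r1.
- by apply: cvgM; [exact: mtq|exact: cvg_cst].
Unshelve. all: by end_near. Qed.

Lemma cvg_sum_increments t : 0 <= t ->
  \sum_(j < Num.truncn (t * s n)) D n j @[n --> \oo] -->
  - (c' / q.+1%:R) * t ^+ q.+1.
Proof.
move=> t0; pose m n := Num.truncn (t * s n).
pose P n := \sum_(j < m n) (j%:R / s n) ^+ q / s n.
have H : \sum_(j < m n) D n j + c' * P n @[n --> \oo] --> (0 : R).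
  apply/cvgr0Pnorm_le => eps e0.
  have T0 : 0 < t + 1 by lra.
  have e1 : 0 < eps / (t + 1) by rewrite divr_gt0.
  near=> n.
  have r1 : 1 <= r n by near: n; exact: near_r1.
  have s0 : 0 < s n by rewrite exprn_gt0// (lt_le_trans _ r1).
  have ts0 : 0 <= t * s n by rewrite mulr_ge0// ltW.
  have mts : (m n)%:R <= t * s n by rewrite truncn_le.
  rewrite /P mulr_sumr -big_split/=.
  apply: le_trans (ler_norm_sum _ _ _) _.
  apply: (@le_trans _ _ (\sum_(j < m n) (eps / (t + 1) / s n))).
    apply: ler_sum => j _.
    have -> : D n j + c' * ((j%:R / s n) ^+ q / s n) =
        (s n * D n j + c' * (j%:R / s n) ^+ q) / s n.
      by field; rewrite gt_eqF.
    rewrite normrM [X in _ * X]gtr0_norm ?invr_gt0// ler_pM2r ?invr_gt0//.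
    have : (j : nat)%:R <= (t + 1) * s n.
      apply: (@le_trans _ _ (m n)%:R); first by rewrite ler_nat ltnW.
      by apply: le_trans mts _; rewrite ler_pM2r// lerDl.
    move: (nat_of_ord j); near: n; exact: scaled_increment.
  rewrite sumr_const card_ord -mulr_natl.
  have -> : (m n)%:R * (eps / (t + 1) / s n) = eps * ((m n)%:R / ((t + 1) * s n)).
    by field; rewrite !gt_eqF.
  rewrite ler_piMr ?(ltW e0)// ler_pdivrMr ?mulr_gt0// mul1r.
  by apply: le_trans mts _; rewrite ler_pM2r// lerDl.
have -> : (fun n => \sum_(j < m n) D n j) =
    (fun n => (\sum_(j < m n) D n j + c' * P n) - c' * P n).
  by apply/funext => n; rewrite addrK.
rewrite -[X in _ --> X]add0r mulNr; apply: cvgB => //.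
rewrite mulrAC -mulrA; apply: cvgM; first exact: cvg_cst.
exact: cvg_sum_power.
Unshelve. all: by end_near. Qed.

(** Beyond a fixed multiple of [s] the increments are at most [- 1 / s], which
    makes the terms decay geometrically; before that they are almost
    nonpositive. *)
Lemma increments_cutoff : exists2 T, 0 < T & forall eta, 0 < eta ->
  \forall n \near \oo, forall m, (m <= M n)%N ->
  \sum_(j < m) D n j <= eta / s n * (minn m (Num.truncn (T * s n)).+1)%:R
    - (s n)^-1 * (m - (Num.truncn (T * s n)).+1)%:R.
Proof.
pose T : R := 2 + (C + 1) / (2 * c).
have Cc0 : 0 < (C + 1) / (2 * c) by rewrite divr_gt0 ?mulr_gt0// ltr_wpDl.
have T0 : 0 < T by rewrite /T; lra.
exists T => // eta eta0; near=> n => m mM.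
have r1 : 1 <= r n by near: n; exact: near_r1.
have r0 : 0 < r n by rewrite (lt_le_trans _ r1).
have s1 : 1 <= s n by rewrite (le_trans r1)// s_ge_r.
have s0 : 0 < s n by rewrite (lt_le_trans _ s1).
have rsn : r n * s n = n%:R by rewrite /s -exprS rn.
have n0 : 0 < n%:R :> R by rewrite -rsn mulr_gt0.
have Ts0 : 0 <= T * s n by rewrite mulr_ge0// ltW.
rewrite -mulNr; apply: (@sum_cutoff _ (D n) _ _ _ (M n)) => // j jM.
have jN : (j < N n)%N by exact: leq_trans jM (MN n).
case: ifPn => jT.
  have jTs : j%:R <= T * s n.
    by apply: (@le_trans _ _ (Num.truncn (T * s n))%:R); rewrite ?ler_nat// truncn_le.
  have : `|s n * D n j + c' * (j%:R / s n) ^+ q| <= eta.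
    by move: {jM jN jT}j jTs; near: n; exact: scaled_increment.
  move=> /(le_trans (ler_norm _)) H; rewrite ler_pdivlMr// mulrC.
  have : 0 <= c' * (j%:R / s n) ^+ q.
    by rewrite mulr_ge0 ?(ltW c'_gt0)// exprn_ge0// divr_ge0// ltW.
  by move: H; lra.
have jTs : T * s n <= j%:R.
  by move: jT; rewrite -leqNgt => jT; apply/ltW; rewrite -truncn_lt_nat.
have [v0 vb] : 0 <= v n j /\ `|n.+1%:R * v n j - 2 * j%:R| <= 2.
  by move: {jM jT jTs}j jN; near: n.
have Db : `|D n j - 2 * G (v n j)| <= C / n%:R.
  by move: {jM jT jTs v0 vb}j jN; near: n.
have Gb : G (v n j) <= - c * v n j ^+ q.
  by move: {jN jT jTs v0 vb Db}j jM; near: n.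
pose V := r n * v n j.
have V1 : T - 1 <= V.
  have : 2 * j%:R - 2 <= n.+1%:R * v n j by move: vb; rewrite ler_norml; lra.
  have : n.+1%:R * v n j <= 2 * n%:R * v n j.
    rewrite ler_wpM2r// -[n.+1]addn1 natrD.
    have : 1 <= n%:R :> R by rewrite -rsn -[1]mul1r ler_pM.
    lra.
  rewrite -rsn => a1 a2.
  have : j%:R - 1 <= V * s n by rewrite /V; move: a1 a2; rewrite -!mulrA; lra.
  move=> a3; rewrite -(ler_pM2r s0); apply: le_trans a3.
  by rewrite mulrBl mul1r; move: jTs s1; lra.
have Vq : V <= V ^+ q.
  by rewrite exprS ler_peMr ?exprn_ege1//; move: V1; rewrite /T; lra.
have sv : s n * v n j ^+ q = V ^+ q by rewrite /V exprMn.
have e1 : D n j <= - (2 * c) * v n j ^+ q + C / n%:R.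
  have := ler_norm (D n j - 2 * G (v n j)); move: Db Gb; lra.
rewrite -[- _]mulN1r ler_pdivlMr//.
apply: (@le_trans _ _ ((- (2 * c) * v n j ^+ q + C / n%:R) * s n)).
  by rewrite ler_pM2r.
have -> : (- (2 * c) * v n j ^+ q + C / n%:R) * s n = - (2 * c) * V ^+ q + C / r n.
  by rewrite -sv -rsn; field; rewrite !gt_eqF.
have Cr : C / r n <= C by rewrite ler_pdivrMr// ler_peMr.
have : 2 * c * (T - 1) <= 2 * c * V ^+ q.
  by rewrite ler_pM2l ?mulr_gt0// (le_trans V1).
have -> : 2 * c * (T - 1) = 2 * c + (C + 1).
  by rewrite /T; field; rewrite gt_eqF.
by rewrite mulNr; have := c0; lra.
Unshelve. all: by end_near. Qed.

Lemma sum_increments_le_min n m :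
  (forall j, (M n <= j < N n)%N -> D n j <= 0) -> (m <= N n)%N ->
  \sum_(j < m) D n j <= \sum_(j < minn m (M n)) D n j.
Proof.
move=> D0n mN; apply: sum_nonpos_tail => j Mj jm.
by rewrite D0n// Mj (leq_trans jm).
Qed.

Lemma sum_increments_le eps : 0 < eps -> \forall n \near \oo,
  forall m, (m <= N n)%N -> \sum_(j < m) D n j <= eps.
Proof.
move=> e0; have [T T0 HT] := increments_cutoff.
pose eta := eps / (T + 1); have eta0 : 0 < eta by rewrite divr_gt0// addr_gt0.
near=> n => m mN.
have r1 : 1 <= r n by near: n; exact: near_r1.
have s1 : 1 <= s n by rewrite (le_trans r1)// s_ge_r.
have s0 : 0 < s n by rewrite (lt_le_trans _ s1).
have D0n : forall j, (M n <= j < N n)%N -> D n j <= 0 by near: n.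
apply: le_trans (sum_increments_le_min _ _ D0n mN) _.
have := geq_minr m (M n); move: (minn m (M n)) => m' m'M.
have /(_ m' m'M) H : forall m, (m <= M n)%N ->
  \sum_(j < m) D n j <= eta / s n * (minn m (Num.truncn (T * s n)).+1)%:R
    - (s n)^-1 * (m - (Num.truncn (T * s n)).+1)%:R.
  by near: n; exact: HT.
apply: le_trans H _; set J := (Num.truncn _).+1.
have h1 : 0 <= (s n)^-1 * (m' - J)%:R by rewrite mulr_ge0// invr_ge0 ltW.
have h2 : (minn m' J)%:R <= (T + 1) * s n.
  apply: (@le_trans _ _ J%:R); first by rewrite ler_nat geq_minr.
  rewrite /J -[_.+1]addn1 natrD mulrDl mul1r lerD//.
  by rewrite truncn_le mulr_ge0// ltW.
have : eta / s n * (minn m' J)%:R <= eta / s n * ((T + 1) * s n).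
  by rewrite ler_pM2l// divr_gt0.
have -> : eta / s n * ((T + 1) * s n) = eps.
  by rewrite /eta; field; rewrite !gt_eqF// addr_gt0.
by move: h1; lra.
Unshelve. all: by end_near. Qed.

(** Beyond the cutoff each increment costs [1 / s] up to the index [M n], and
    stopping there loses at most half of the decay because [m <= 2 * M n + 1]. *)
Lemma sum_increments_decay : exists B, \forall n \near \oo,
  forall m, (m <= N n)%N -> \sum_(j < m) D n j <= B - 2^-1 * (m%:R / s n).
Proof.
have [T T0 HT] := increments_cutoff; exists (2 * T + 3).
near=> n => m mN.
have r1 : 1 <= r n by near: n; exact: near_r1.
have s1 : 1 <= s n by rewrite (le_trans r1)// s_ge_r.
have s0 : 0 < s n by rewrite (lt_le_trans _ s1).
have -> : 2 * T + 3 - 2^-1 * (m%:R / s n) =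
  (s n)^-1 * (2 * T * s n + 3 * s n - m%:R / 2) by field; rewrite gt_eqF.
have D0n : forall j, (M n <= j < N n)%N -> D n j <= 0 by near: n.
apply: le_trans (sum_increments_le_min _ _ D0n mN) _.
pose m' := minn m (M n).
have m'M : (m' <= M n)%N by exact: geq_minr.
have mm' : m%:R <= 2 * m'%:R + 1 :> R.
  have -> : 2 * m'%:R + 1 = (m'.*2.+1)%:R :> R.
    by rewrite -(addn1 m'.*2) natrD -mul2n natrM.
  by rewrite ler_nat /m'; have := NM n; lia.
rewrite -/m'.
have /(_ m' m'M) H : forall m, (m <= M n)%N ->
  \sum_(j < m) D n j <= 1 / s n * (minn m (Num.truncn (T * s n)).+1)%:R
    - (s n)^-1 * (m - (Num.truncn (T * s n)).+1)%:R.
  by near: n; exact: HT.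
apply: le_trans H _; set J := (Num.truncn _).+1.
have JT : J%:R <= T * s n + 1.
  by rewrite /J -[_.+1]addn1 natrD lerD// truncn_le mulr_ge0// ltW.
have h1 : (minn m' J)%:R <= J%:R :> R by rewrite ler_nat geq_minr.
have h2 : m'%:R - J%:R <= (m' - J)%:R :> R.
  by rewrite lerBlDr -natrD ler_nat; lia.
rewrite mul1r -mulrBr ler_pM2l ?invr_gt0//.
exact: (decay_arith _ _ _ _ _ _ _ mm' JT h1 h2 s1).
Unshelve. all: by end_near. Qed.

(** The factors [u] carry the weight of the mirror levels.  The linear decay of
    the exponents is the exponential majorant that [cvg_riemann_sum] asks for. *)
Lemma cvg_laplace_sum (u : nat -> nat -> R) (uinf : R) :
  (\forall n \near \oo, forall m, (m <= N n)%N -> 0 <= u n m <= 1) ->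
  (forall t, 0 <= t -> u n (Num.truncn (t * s n)) @[n --> \oo] --> uinf) ->
  (s n)^-1 * \sum_(m < (N n).+1) expR (\sum_(j < m) D n j) * u n m @[n --> \oo] -->
  Rintegral (@lebesgue_measure R) `[0, +oo[
    (fun t => expR (- (c' / q.+1%:R) * t ^+ q.+1) * uinf).
Proof.
move=> u01 cu; have [B HB] := sum_increments_decay.
apply: (@cvg_riemann_sum R s (fun n => (N n).+1)
  (fun n m => expR (\sum_(j < m) D n j) * u n m)
  (fun t => expR (- (c' / q.+1%:R) * t ^+ q.+1) * uinf) (expR B) 2^-1) => //.
- exact: s_cvgy.
- apply/cvgryPge => A; near=> n; apply: (@le_trans _ _ ((N n)%:R / s n)).
    by near: n; move/cvgryPge: Ns; exact.
  have r1 : 1 <= r n by near: n; exact: near_r1.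
  by rewrite ler_pM2r ?ler_nat// invr_gt0 exprn_gt0// (lt_le_trans _ r1).
- near=> n => m mN.
  have /andP[u0 u1] : 0 <= u n m <= 1 by move: mN; rewrite ltnS; move: m; near: n.
  rewrite mulr_ge0 ?expR_ge0//=; apply: (@le_trans _ _ (expR (\sum_(j < m) D n j))).
    by rewrite ler_piMr ?expR_ge0.
  rewrite -expRD ler_expR mulNr; move: mN; rewrite ltnS; move: m {u0 u1}; near: n.
  exact: HB.
- apply: continuous_measurable_Rpos => x; apply: cvgM; last exact: cvg_cst.
  apply: continuous_comp; last exact: continuous_expR.
  by apply: cvgM; [exact: cvg_cst|exact: exprn_continuous].
- move=> t t0; apply: cvgM; last exact: cu.
  apply: continuous_cvg; first exact: continuous_expR.
  exact: cvg_sum_increments.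
Unshelve. all: by end_near. Qed.

End LaplaceIncrements.

(** * Asymptotics of the total weight *)

Section Scales.
Context {R : realType} (p : nat).

(** When the mean-field function vanishes to order [p + 1] at its root, the peak
    of the level weights has width [scale n = n ^ ((p + 1) / (p + 2))]. *)
Definition scale_root (n : nat) : R := n%:R `^ (p.+2%:R)^-1.
Definition scale (n : nat) : R := scale_root n ^+ p.+1.

Lemma scale_rootX n : scale_root n ^+ p.+2 = n%:R.
Proof. by rewrite -powR_mulrn ?powR_ge0// -powRrM mulVf ?powRr1. Qed.

Lemma scale_root_cvgy : scale_root n @[n --> \oo] --> +oo.
Proof.
apply: (@cvg_comp _ _ _ (fun n : nat => n%:R : R) (fun x : R => x `^ (p.+2%:R)^-1)).
  exact: cvgr_idn.
by apply: cvg_powRy; rewrite invr_gt0.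
Qed.

Lemma scale_cvgy : scale n @[n --> \oo] --> +oo.
Proof. exact: s_cvgy scale_root_cvgy. Qed.

Lemma near_scale_gt0 : \forall n \near \oo, 0 < scale n.
Proof. by move/cvgryPgt: scale_cvgy; exact. Qed.

Lemma div_scale_cvgy (a : R) (N : nat -> nat) : 0 < a ->
  (forall n, a * n%:R - 2 <= 2 * (N n)%:R) ->
  (N n)%:R / scale n @[n --> \oo] --> +oo.
Proof.
move=> a0 aN; apply/cvgryPge => A; near=> n.
have r1 : 1 <= scale_root n by near: n; move/cvgryPge: scale_root_cvgy; exact.
have r0 : 0 < scale_root n by exact: lt_le_trans r1.
have s1 : 1 <= scale n by rewrite exprn_ege1.
have s0 : 0 < scale n by exact: lt_le_trans s1.
have rs : scale_root n * scale n = n%:R by rewrite /scale -exprS scale_rootX.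
have rA : 2 * (`|A| + 1) / a <= scale_root n.
  by near: n; move/cvgryPge: scale_root_cvgy; exact.
apply: le_trans (ler_norm A) _; rewrite ler_pdivlMr//.
have := aN n; rewrite -rs => H; move: rA; rewrite ler_pdivrMr// => rA.
have : 2 * (`|A| + 1) * scale n <= scale_root n * a * scale n by rewrite ler_pM2r.
by move: H; rewrite !mulrA; lra.
Unshelve. all: by end_near. Qed.

End Scales.

Section OneSidedSums.
Context {R : realType} (b h z kappa c : R) (p : nat).
Context (b0 : 0 <= b) (z0 : 0 <= z) (z1 : z < 1) (kappa0 : 0 < kappa) (c0 : 0 < c).
Local Notation g := (mf_field b h).
Local Notation w := (level_weight b h).
Local Notation k0 := (ref_level z).
Local Notation s := (@scale R p).

(** The limiting profile of the level weights at distance [t * s] from the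
    peak. *)
Definition laplace_fun (t : R) : R :=
  expR (- (2 ^+ p.+2 * kappa / p.+2%:R) * t ^+ p.+2).

Let vr n j := midpoint n (k0 n + j) - z.
Let Dr n j := log_ratio b h n (k0 n + j).

Lemma log_ratio_error n k : (k < n)%N ->
  `|log_ratio b h n k - 2 * g (midpoint n k)| <= 2 * b / n%:R.
Proof.
move=> kn; have /andP[y1 y2] := @midpoint_itv R n k kn.
have n0 : 0 < n%:R :> R by rewrite ltr0n (leq_ltn_trans _ kn).
rewrite /log_ratio addrAC subrr add0r normrM [X in _ * X]ger0_norm ?invr_ge0 ?(ltW n0)//.
rewrite ler_pM2r ?invr_gt0// normrM ger0_norm; last by rewrite mulr_ge0//.
rewrite ler_piMr ?mulr_ge0//.
by rewrite ler_norml !ltW.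
Qed.

Lemma right_offset n j : 0 <= vr n j /\ `|n.+1%:R * vr n j - 2 * j%:R| <= 2.
Proof.
have E : n.+1%:R * vr n j = n.+1%:R * (midpoint n (k0 n) - z) + 2 * j%:R.
  by rewrite /vr !mulrBr !midpointM natrD; ring.
have /andP[lo hi] := @midpoint_ref R z z0 n.
split; last by rewrite E addrK ger0_norm// ltW.
rewrite -(pmulr_rge0 _ (ltr0Sn R n)) E addr_ge0 ?(ltW lo)// mulr_ge0.
Qed.

Lemma right_length n : (1 - z) * n%:R - 2 <= 2 * (n - k0 n)%:R.
Proof.
rewrite natrB ?ref_level_le//; have /andP[lo _] := @ref_level_bounds R z z0 n.
by move: lo; rewrite -natr1; have := z1; lra.
Qed.

Section Right.
Context (gloc : forall eps, 0 < eps -> exists2 delta, 0 < delta &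
   forall x, 0 <= x <= delta -> `|g (z + x) + kappa * x ^+ p.+1| <= eps * x ^+ p.+1).
Context (gle : forall x, 0 <= x -> z + x < 1 -> g (z + x) <= - c * x ^+ p.+1).

(** The hypotheses on log-increments hold for the levels above the peak, where
    the bound on the field reaches up to the last level. *)
Lemma right_hyps : [/\
  (n - k0 n)%:R / s n @[n --> \oo] --> +oo,
  \forall n \near \oo, forall j, (j < n - k0 n)%N ->
    0 <= vr n j /\ `|n.+1%:R * vr n j - 2 * j%:R| <= 2,
  \forall n \near \oo, forall j, (j < n - k0 n)%N ->
   `|Dr n j - 2 * g (z + vr n j)| <= 2 * b / n%:R,
  \forall n \near \oo, forall j, (j < n - k0 n)%N ->
   g (z + vr n j) <= - c * vr n j ^+ p.+1 &
  \forall n \near \oo, forall j, (n - k0 n <= j < n - k0 n)%N -> Dr n j <= 0].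
Proof.
have lt_n n j : (j < n - k0 n)%N -> (k0 n + j < n)%N by lia.
have zv n j : z + vr n j = midpoint n (k0 n + j) by rewrite /vr addrC subrK.
split.
- by apply: (@div_scale_cvgy R p (1 - z)); [have := z1; lra|exact: right_length].
- by apply: nearW => n j _; exact: right_offset.
- apply: nearW => n j /lt_n jn; rewrite zv.
  exact: log_ratio_error.
- apply: nearW => n j /lt_n jn; apply: gle; first by have [] := right_offset n j.
  by rewrite zv; have /andP[] := @midpoint_itv R n _ jn.
- by apply: nearW => n j; lia.
Qed.

Lemma right_le eps : 0 < eps -> \forall n \near \oo,
  forall m, (m <= n - k0 n)%N -> w n (k0 n + m) <= w n (k0 n) * expR eps.
Proof.
move=> e0; have [h1 h2 h3 h4 h5] := right_hyps.
have := @sum_increments_le R p (@scale_root R p) kappa c (2 * b)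
  (fun x => g (z + x)) (fun n => n - k0 n)%N (fun n => n - k0 n)%N Dr vr.
move=> /(_ (scale_root_cvgy p) (scale_rootX p) h1 kappa0 c0).
move=> /(_ (mulr_ge0 (ler0n _ 2) b0) gloc h2 h3 h4 h5 (fun=> leqnn _)) H.
have {}H := H _ e0.
near=> n => m mn; rewrite level_weight_right; last first.
  by have := @ref_level_le R z z0 z1 n; lia.
rewrite ler_pM2l ?level_weight_gt0 ?ref_level_le// ler_expR.
by move: m mn; near: n; exact: H.
Unshelve. all: by end_near. Qed.

Lemma right_sum (u : nat -> nat -> R) (uinf : R) :
  (\forall n \near \oo, forall m, (m <= n - k0 n)%N -> 0 <= u n m <= 1) ->
  (forall t, 0 <= t -> u n (Num.truncn (t * s n)) @[n --> \oo] --> uinf) ->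
  (s n)^-1 * \sum_(m < (n - k0 n).+1) w n (k0 n + m) / w n (k0 n) * u n m
    @[n --> \oo] -->
  Rintegral (@lebesgue_measure R) `[0, +oo[ (fun t => laplace_fun t * uinf).
Proof.
move=> u01 cu; have [h1 h2 h3 h4 h5] := right_hyps.
have := @cvg_laplace_sum R p (@scale_root R p) kappa c (2 * b)
  (fun x => g (z + x)) (fun n => n - k0 n)%N (fun n => n - k0 n)%N Dr vr.
move=> /(_ (scale_root_cvgy p) (scale_rootX p) h1 kappa0 c0).
move=> /(_ (mulr_ge0 (ler0n _ 2) b0) gloc h2 h3 h4 h5 (fun=> leqnn _)) H.
apply: cvg_trans (H _ u uinf u01 cu); last by move=> n; lia.
apply: near_eq_cvg; near=> n; congr (_ * _); apply: eq_bigr => m _.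
have kn := @ref_level_le R z z0 z1 n.
rewrite level_weight_right; last by have := ltn_ord m; lia.
by rewrite [w n (k0 n) * _]mulrC mulfK// gt_eqF// level_weight_gt0.
Unshelve. all: by end_near. Qed.

End Right.

Let vl n j := z - midpoint n (k0 n - j.+1).
Let Dl n j := - log_ratio b h n (k0 n - j.+1).
Let Nl n := (k0 n - uphalf n)%N.

Lemma left_offset n j : (j < Nl n)%N ->
  0 <= vl n j /\ `|n.+1%:R * vl n j - 2 * j%:R| <= 2.
Proof.
move=> jN; have jk : (j.+1 <= k0 n)%N by rewrite /Nl in jN; lia.
have E : n.+1%:R * vl n j = 2 - n.+1%:R * (midpoint n (k0 n) - z) + 2 * j%:R.
  by rewrite /vl !mulrBr !midpointM natrB// -[j.+1]addn1 natrD; ring.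
have /andP[lo hi] := @midpoint_ref R z z0 n.
split; last by rewrite E addrK ger0_norm; lra.
by rewrite -(pmulr_rge0 _ (ltr0Sn R n)) E addr_ge0 ?mulr_ge0//; lra.
Qed.

Lemma left_length n : z * n%:R - 2 <= 2 * (Nl n)%:R.
Proof.
rewrite natrB ?ref_level_ge//; have /andP[_ hi] := @ref_level_bounds R z z0 n.
have : 2 * (uphalf n)%:R <= n%:R + 1 :> R by rewrite -natrM natr1 ler_nat; lia.
by move: hi; rewrite -natr1; have := z0; lra.
Qed.

Lemma left_midpoint_ge0 n j : (j < Nl n)%N -> 0 <= midpoint n (k0 n - j.+1) :> R.
Proof.
move=> jN; rewrite -(pmulr_rge0 _ (ltr0Sn R n)) midpointM subr_ge0.
by rewrite -natrM natr1 ler_nat; rewrite /Nl in jN; lia.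
Qed.

Lemma left_midpoint_half n j : (j < (Nl n)./2)%N ->
  z / 2 <= midpoint n (k0 n - j.+1) :> R.
Proof.
move=> jN; rewrite -(ler_pM2l (ltr0Sn R n)) midpointM.
have kn := @ref_level_ge R z z0 z1 n.
have jk : (j.+1 <= k0 n)%N by rewrite /Nl in jN; lia.
have /andP[lo hi] := @ref_level_bounds R z z0 n.
have a1 : (2 * (j.+1%:R + j.+1%:R) + n%:R : R) <= 2 * (k0 n)%:R.
  rewrite -natrD -natrM -natrD -natrM ler_nat; rewrite /Nl in jN; lia.
rewrite natrB//; move: a1 hi; rewrite -[n.+1]addn1 natrD; lra.
Qed.

Section Left.
Context (zp : 0 < z).
Context (gloc : forall eps, 0 < eps -> exists2 delta, 0 < delta &
   forall x, 0 <= x <= delta -> `|- g (z - x) + kappa * x ^+ p.+1| <= eps * x ^+ p.+1).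
Context (gge : forall y, z / 2 <= y <= z -> c * (z - y) ^+ p.+1 <= g y).
Context (g0 : forall y, 0 <= y <= z -> 0 <= g y).

(** The same for the levels below the peak.  The linear lower bound on the field
    is available at magnetisations above [z / 2], hence on half of the range;
    on the rest the field is nonnegative. *)
Lemma left_hyps : [/\
  (Nl n)%:R / s n @[n --> \oo] --> +oo,
  \forall n \near \oo, forall j, (j < Nl n)%N ->
    0 <= vl n j /\ `|n.+1%:R * vl n j - 2 * j%:R| <= 2,
  \forall n \near \oo, forall j, (j < Nl n)%N ->
   `|Dl n j - 2 * - g (z - vl n j)| <= 2 * b / n%:R,
  \forall n \near \oo, forall j, (j < (Nl n)./2)%N ->
   - g (z - vl n j) <= - c * vl n j ^+ p.+1 &
  \forall n \near \oo, forall j, ((Nl n)./2 <= j < Nl n)%N -> Dl n j <= 0].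
Proof.
have lt_n n j : (j < Nl n)%N -> (k0 n - j.+1 < n)%N.
  by rewrite /Nl; have := @ref_level_le R z z0 z1 n; lia.
have zv n j : z - vl n j = midpoint n (k0 n - j.+1).
  by rewrite /vl opprB addrC subrK.
have yz n j : (j < Nl n)%N -> midpoint n (k0 n - j.+1) <= z.
  by move=> /left_offset[]; rewrite /vl subr_ge0.
split.
- by apply: (@div_scale_cvgy R p z) => //; exact: left_length.
- by apply: nearW => n j; exact: left_offset.
- apply: nearW => n j /lt_n jn.
  rewrite zv /Dl mulrN -opprD normrN.
  exact: log_ratio_error.
- apply: nearW => n j jN; have jN' : (j < Nl n)%N by lia.
  rewrite zv mulNr lerN2; apply: gge.
  by rewrite left_midpoint_half// yz.
- apply: nearW => n j /andP[_ jN]; rewrite /Dl oppr_le0 /log_ratio.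
  have y0 := left_midpoint_ge0 _ _ jN.
  apply: addr_ge0; first by rewrite mulr_ge0// g0// y0 yz.
  by apply: divr_ge0 => //; apply: mulr_ge0 => //; exact: mulr_ge0.
Qed.

Lemma left_le eps : 0 < eps -> \forall n \near \oo,
  forall m, (m <= Nl n)%N -> w n (k0 n - m) <= w n (k0 n) * expR eps.
Proof.
move=> e0; have [h1 h2 h3 h4 h5] := left_hyps.
have hN n : ((Nl n)./2 <= Nl n)%N by lia.
have := @sum_increments_le R p (@scale_root R p) kappa c (2 * b)
  (fun x => - g (z - x)) Nl (fun n => (Nl n)./2) Dl vl.
move=> /(_ (scale_root_cvgy p) (scale_rootX p) h1 kappa0 c0).
move=> /(_ (mulr_ge0 (ler0n _ 2) b0) gloc h2 h3 h4 h5 hN) H.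
have {}H := H _ e0.
near=> n => m mn; rewrite level_weight_left ?ref_level_le//; last first.
  by rewrite /Nl in mn; lia.
rewrite ler_pM2l ?level_weight_gt0 ?ref_level_le// ler_expR.
by move: m mn; near: n; exact: H.
Unshelve. all: by end_near. Qed.

Lemma left_sum (u : nat -> nat -> R) (uinf : R) :
  (\forall n \near \oo, forall m, (m <= Nl n)%N -> 0 <= u n m <= 1) ->
  (forall t, 0 <= t -> u n (Num.truncn (t * s n)) @[n --> \oo] --> uinf) ->
  (s n)^-1 * \sum_(m < (Nl n).+1) w n (k0 n - m) / w n (k0 n) * u n m
    @[n --> \oo] -->
  Rintegral (@lebesgue_measure R) `[0, +oo[ (fun t => laplace_fun t * uinf).
Proof.
move=> u01 cu; have [h1 h2 h3 h4 h5] := left_hyps.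
have hN n : ((Nl n)./2 <= Nl n)%N by lia.
have := @cvg_laplace_sum R p (@scale_root R p) kappa c (2 * b)
  (fun x => - g (z - x)) Nl (fun n => (Nl n)./2) Dl vl.
move=> /(_ (scale_root_cvgy p) (scale_rootX p) h1 kappa0 c0).
move=> /(_ (mulr_ge0 (ler0n _ 2) b0) gloc h2 h3 h4 h5 hN) H.
apply: cvg_trans (H _ u uinf u01 cu); last by move=> n; lia.
apply: near_eq_cvg; near=> n; congr (_ * _); apply: eq_bigr => m _.
have kn := @ref_level_le R z z0 z1 n.
rewrite level_weight_left//; last by have := ltn_ord m; rewrite /Nl; lia.
by rewrite [w n (k0 n) * _]mulrC mulfK// gt_eqF// level_weight_gt0.
Unshelve. all: by end_near. Qed.

End Left.

End OneSidedSums.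

Section TotalWeight.
Context {R : realType} (b h z kappa c : R) (p : nat).
Context (b0 : 0 <= b) (h0 : 0 <= h) (z0 : 0 <= z) (z1 : z < 1).
Context (kappa0 : 0 < kappa) (c0 : 0 < c).
Local Notation g := (mf_field b h).
Local Notation w := (level_weight b h).
Local Notation k0 := (ref_level z).
Local Notation s := (@scale R p).
Local Notation I :=
  (Rintegral (@lebesgue_measure R) `[0, +oo[ (@laplace_fun R kappa p)).
Context (gloc : forall eps, 0 < eps -> exists2 delta, 0 < delta &
   forall x, 0 <= x <= delta -> `|g (z + x) + kappa * x ^+ p.+1| <= eps * x ^+ p.+1).
Context (gle : forall x, 0 <= x -> z + x < 1 -> g (z + x) <= - c * x ^+ p.+1).
(* If z = 0, folding leaves no level on the left of the peak. *)
Context (gleft : z = 0 \/ [/\ 0 < z,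
   forall eps, 0 < eps -> exists2 delta, 0 < delta &
     forall x, 0 <= x <= delta -> `|- g (z - x) + kappa * x ^+ p.+1| <= eps * x ^+ p.+1,
   forall y, z / 2 <= y <= z -> c * (z - y) ^+ p.+1 <= g y &
   forall y, 0 <= y <= z -> 0 <= g y]).
(* The limit of [flip_ratio] at distance O(s) from the peak: the mirror peak is
   as high if h = 0, and negligible if h > 0. *)
Context (q : R) (hq : (h = 0 /\ q = 1) \/ [/\ 0 < h, 0 < z & q = 0]).

(** A level below the middle is dominated by its mirror image, as [h >= 0]; the
    others are reached from the peak by increments whose sums are small when
    positive. *)
Lemma level_weight_le_ref eps : 0 < eps -> \forall n \near \oo,
  forall k, (k <= n)%N -> w n k <= w n (k0 n) * expR eps.
Proof.
move=> e0; have HR := @right_le R b h z kappa c p b0 z0 z1 kappa0 c0 gloc gle eps e0.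
have HL : \forall n \near \oo,
    forall m, (m <= k0 n - uphalf n)%N -> w n (k0 n - m) <= w n (k0 n) * expR eps.
  case: gleft => [zE|[zp l1 l2 l3]]; last exact: (@left_le R b h z kappa c p b0 z0 z1 kappa0 c0 zp l1 l2 l3 eps e0).
  apply: nearW => n m; rewrite ref_level0// subnn leqn0 => /eqP ->.
  have e1 : 1 <= expR eps by rewrite -expR0 ler_expR ltW.
  by rewrite subn0 ler_peMr// ltW// level_weight_gt0//; lia.
near=> n => k kn.
have kk := @ref_level_ge R z z0 z1 n.
have up j : (uphalf n <= j <= n)%N -> w n j <= w n (k0 n) * expR eps.
  move=> /andP[uj jn]; have [kj|jk] := leqP (k0 n) j.
    have -> : j = (k0 n + (j - k0 n))%N by lia.
    have : (j - k0 n <= n - k0 n)%N by lia.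
    by move: (j - k0 n)%N; near: n.
  have -> : j = (k0 n - (k0 n - j))%N by lia.
  have : (k0 n - j <= k0 n - uphalf n)%N by lia.
  by move: (k0 n - j)%N; near: n.
have [uk|ku] := leqP (uphalf n) k; first by apply: up; rewrite uk.
have nk : (uphalf n <= n - k <= n)%N by lia.
apply: le_trans (up _ nk).
rewrite -{1}(subKn kn) level_weight_flip ?leq_subr//.
rewrite ler_piMr//; first by rewrite ltW// level_weight_gt0// leq_subr.
have nk2 : (n <= (n - k).*2)%N by lia.
by have /andP[] := flip_ratio_itv h n (n - k) h0 nk2.
Unshelve. all: by end_near. Qed.

Lemma flip_ratio_cvg (k : nat -> nat) (t : R) :
  (\forall n \near \oo, 2 * (k0 n)%:R - 2 * t * s n <= 2 * (k n)%:R) ->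
  flip_ratio h n (k n) @[n --> \oo] --> q.
Proof.
move=> kt; case: hq => [[hE ->]|[hp zp ->]].
  apply: (@cvg_trans _ (cst 1 @ \oo)); last exact: cvg_cst.
  apply: near_eq_cvg; near=> n.
  by rewrite /flip_ratio hE mulr0 oppr0 mul0r expR0.
have ky : (2 * (k n)%:R - n%:R : R) @[n --> \oo] --> +oo.
  apply/cvgryPge => A; near=> n.
  have r1 : 1 <= @scale_root R p n.
    by near: n; move/cvgryPge: (@scale_root_cvgy R p); exact.
  have rt : (2 * `|t| + `|A| + 2) / z <= @scale_root R p n.
    by near: n; move/cvgryPge: (@scale_root_cvgy R p); exact.
  have s1 : 1 <= s n by rewrite exprn_ege1.
  have rs : @scale_root R p n * s n = n%:R by rewrite /scale -exprS scale_rootX.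
  have kn : 2 * (k0 n)%:R - 2 * t * s n <= 2 * (k n)%:R by near: n.
  have /andP[_ hi] := @ref_level_bounds R z z0 n.
  move: rt; rewrite ler_pdivrMr// => rt.
  have H1 : (2 * `|t| + `|A| + 2) * s n <= z * n%:R.
    by rewrite -rs mulrA ler_pM2r ?(lt_le_trans _ s1)// [z * _]mulrC.
  have H2 : t * s n <= `|t| * s n by rewrite ler_pM2r ?ler_norm// (lt_le_trans _ s1).
  have H3 : `|A| <= `|A| * s n by rewrite ler_peMr.
  have H4 := ler_norm A.
  move: hi H1; rewrite -natr1 !mulrDl !mulrDr !mul1r !mulr1 [n%:R * z]mulrC => hi H1.
  by have := z0; lra.
have : expR (- ((2 * h) * (2 * (k n)%:R - n%:R))) @[n --> \oo] --> (0 : R).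
  apply: (@cvg_comp _ _ _ (fun n => 2 * h * (2 * (k n)%:R - n%:R)) (fun x : R => expR (- x))).
    apply/cvgryPge => A; near=> n.
    have : A / (2 * h) <= 2 * (k n)%:R - n%:R by near: n; move/cvgryPge: ky; exact.
    by rewrite ler_pdivrMr ?mulr_gt0// mulrC.
  exact: cvgr_expR.
by rewrite (_ : (fun n => expR _) = fun n => flip_ratio h n (k n))//;
  apply/funext => n; rewrite /flip_ratio mulNr.
Unshelve. all: by end_near. Qed.

Lemma Rintegral_laplace_fun_mulr (x : R) : x = 0 \/ x = 1 ->
  Rintegral (@lebesgue_measure R) `[0, +oo[ (fun t => laplace_fun kappa p t * x)
  = I * x.
Proof.
case=> ->; last by under eq_Rintegral do rewrite mulr1; rewrite mulr1.
under eq_Rintegral do rewrite mulr0.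
by rewrite mulr0 Rintegral_cst ?mul0r//; exact: measurable_itv.
Qed.

Let q01 : q = 0 \/ q = 1.
Proof. by case: hq => [[_]|[_ _]]; [right|left]. Qed.

(** Common to the two sides of the peak, which provide the hypothesis on
    [F]. *)
Lemma folded_sum (F : nat -> nat -> R) (k : nat -> nat -> nat) (N : nat -> nat) :
  (forall u uinf, (\forall n \near \oo, forall m, (m <= N n)%N -> 0 <= u n m <= 1) ->
    (forall t, 0 <= t -> u n (Num.truncn (t * s n)) @[n --> \oo] --> uinf) ->
    (s n)^-1 * \sum_(m < (N n).+1) F n m * u n m @[n --> \oo] -->
    Rintegral (@lebesgue_measure R) `[0, +oo[ (fun t => laplace_fun kappa p t * uinf)) ->
  (forall n m, (m <= N n)%N -> (n <= (k n m).*2)%N) ->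
  (forall n m, 2 * (k0 n)%:R - 2 * m%:R <= 2 * (k n m)%:R :> R) ->
  (s n)^-1 * \sum_(m < (N n).+1) F n m * (1 + flip_ratio h n (k n m)) @[n --> \oo]
    --> I * (1 + q).
Proof.
move=> HF kN km.
have -> : (fun n => (s n)^-1 * \sum_(m < (N n).+1) F n m * (1 + flip_ratio h n (k n m))) =
    (fun n => (s n)^-1 * \sum_(m < (N n).+1) F n m * 1 +
      (s n)^-1 * \sum_(m < (N n).+1) F n m * flip_ratio h n (k n m)).
  apply/funext => n; rewrite -mulrDr -big_split/=; congr (_ * _).
  by apply: eq_bigr => m _; rewrite mulrDr.
rewrite mulrDr; apply: cvgD.
  rewrite -Rintegral_laplace_fun_mulr; last by right.
  apply: (HF (fun _ _ => 1) 1); first by apply: nearW => n m _; rewrite ler01 lexx.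
  by move=> t _; exact: cvg_cst.
rewrite -Rintegral_laplace_fun_mulr//.
apply: (HF (fun n m => flip_ratio h n (k n m)) q).
  by apply: nearW => n m mN; apply: flip_ratio_itv => //; exact: kN.
move=> t t0; apply: (@flip_ratio_cvg _ t); near=> n.
apply: le_trans (km n _); rewrite lerD2l lerN2 -mulrA ler_pM2l//.
rewrite truncn_le mulr_ge0// ltW//; near: n; exact: near_scale_gt0.
Unshelve. all: by end_near. Qed.

(** The factor [1 + q] accounts for the mirror peak, the last one for the side of
    the peak that faces the origin.  The central level and the level of the
    peak, each counted twice, are negligible at scale [s]. *)
Lemma total_weight_cvg :
  (s n)^-1 * ((\sum_(k < n.+1) w n k) / w n (k0 n)) @[n --> \oo] -->
  I * (1 + q) * (1 + (0 < z)%R%:R).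
Proof.
have kle n := @ref_level_le R z z0 z1 n.
have kge n := @ref_level_ge R z z0 z1 n.
pose F n k := w n k / w n (k0 n) * (1 + flip_ratio h n k).
pose SR n := \sum_(m < (n - k0 n).+1) F n (k0 n + m)%N.
pose SL n := \sum_(m < (k0 n - uphalf n).+1) F n (k0 n - m)%N - F n (k0 n).
pose E n := if odd n then 0 else w n (uphalf n) / w n (k0 n).
have -> : (fun n => (s n)^-1 * ((\sum_(k < n.+1) w n k) / w n (k0 n))) =
    (fun n => (s n)^-1 * SR n + (s n)^-1 * SL n - (s n)^-1 * E n).
  apply/funext => n; rewrite -mulrDr -mulrBr; congr (_ * _).
  rewrite sum_level_weight_fold (@sum_split_at _ (fun k => w n k * (1 + flip_ratio h n k)) _ (k0 n))//.
  rewrite /SR /SL /E /F mulrBl addrA [(_ - _) / _]mulrBl mulrDl !mulr_suml.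
  congr (_ - _); last by case: ifP; rewrite ?mul0r.
  by congr (_ + _ - _); [apply: eq_bigr => m _| apply: eq_bigr => m _|];
    rewrite mulrAC.
have invs : (s n)^-1 @[n --> \oo] --> (0 : R).
  by apply/gtr0_cvgV0; [exact: near_scale_gt0|exact: scale_cvgy].
have cE : (s n)^-1 * E n @[n --> \oo] --> (0 : R).
  apply: (@squeeze_cvgr _ _ _ _ (fun=> 0) (fun n => (s n)^-1 * expR 1)).
  - near=> n; have s0 : 0 < s n by near: n; exact: near_scale_gt0.
    have H : forall k, (k <= n)%N -> w n k <= w n (k0 n) * expR 1.
      by near: n; exact: level_weight_le_ref.
    rewrite /E; case: ifP => _; first by rewrite mulr0 lexx mulr_ge0 ?expR_ge0// invr_ge0 ltW.
    have wk := @level_weight_gt0 R b h n (k0 n) (kle n).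
    have un : (uphalf n <= n)%N by have := kle n; have := kge n; lia.
    rewrite mulr_ge0 ?invr_ge0 ?divr_ge0 ?(ltW s0) ?(ltW wk) ?(ltW (level_weight_gt0 _ _ _ _ _))//=.
    by rewrite ler_pM2l ?invr_gt0// ler_pdivrMr// mulrC H.
  - exact: cvg_cst.
  - by rewrite -[X in _ --> X](mul0r (expR 1)); apply: cvgM => //; exact: cvg_cst.
have cR : (s n)^-1 * SR n @[n --> \oo] --> I * (1 + q).
  apply: (@folded_sum (fun n m => w n (k0 n + m) / w n (k0 n)) (fun n m => k0 n + m)%N
    (fun n => n - k0 n)%N).
  - exact: (@right_sum R b h z kappa c p b0 z0 z1 kappa0 c0 gloc gle).
  - by move=> n m _; have := kge n; lia.
  - by move=> n m; rewrite natrD; have : 0 <= m%:R :> R by []; lra.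
have cF : (s n)^-1 * F n (k0 n) @[n --> \oo] --> (0 : R).
  apply: (@squeeze_cvgr _ _ _ _ (fun=> 0) (fun n => (s n)^-1 * 2)).
  - near=> n; have s0 : 0 < s n by near: n; exact: near_scale_gt0.
    have wk := @level_weight_gt0 R b h n (k0 n) (kle n).
    rewrite /F divff ?gt_eqF// mul1r ler_pM2l ?invr_gt0//.
    have /andP[f0 f1] : 0 <= flip_ratio h n (k0 n) <= 1.
      by apply: flip_ratio_itv => //; have := kge n; lia.
    by rewrite mulr_ge0 ?invr_ge0 ?(ltW s0) ?addr_ge0//=; lra.
  - exact: cvg_cst.
  - by rewrite -[X in _ --> X](mul0r 2); apply: cvgM => //; exact: cvg_cst.
have cL : (s n)^-1 * SL n @[n --> \oo] --> I * (1 + q) * (0 < z)%R%:R.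
  case: gleft => [zE|[zp l1 l2 l3]].
    have -> : (0 < z)%R = false by rewrite zE ltxx.
    rewrite mulr0; apply: (@cvg_trans _ (cst (0 : R) @ \oo)); last exact: cvg_cst.
    apply: near_eq_cvg; near=> n; rewrite /SL ref_level0// subnn big_ord1 subn0.
    by rewrite subrr mulr0.
  rewrite zp mulr1 /SL.
  have -> : I * (1 + q) = I * (1 + q) - 0 by rewrite subr0.
  rewrite (_ : (fun n => _) = fun n => (s n)^-1 * \sum_(m < (k0 n - uphalf n).+1) F n (k0 n - m)%N
      - (s n)^-1 * F n (k0 n)); last by apply/funext => n; rewrite mulrBr.
  apply: cvgB => //.
  apply: (@folded_sum (fun n m => w n (k0 n - m) / w n (k0 n)) (fun n m => k0 n - m)%N
    (fun n => k0 n - uphalf n)%N).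
  - exact: (@left_sum R b h z kappa c p b0 z0 z1 kappa0 c0 zp l1 l2 l3).
  - by move=> n m; have := kge n; lia.
  - move=> n m; have : (k0 n <= (k0 n - m) + m)%N by lia.
    by rewrite -(ler_nat R) natrD; lra.
rewrite -[X in _ --> X]subr0; apply: cvgB => //.
by rewrite mulrDr mulr1; exact: cvgD.
Unshelve. all: by end_near. Qed.

End TotalWeight.

(** * The concentration function *)

Section Conclusion.
Context {R : realType}.
Implicit Types b h : R.

Lemma level_weightN b h n k : (k <= n)%N ->
  level_weight b (- h) n (n - k) = level_weight b h n k.
Proof.
move=> kn; rewrite /level_weight bin_sub// natrB//.
by congr (_ * expR _); ring.
Qed.

(** Reversing all the spins exchanges the levels [k] and [n - k]. *)
Lemma Qplus_oppr d (beta h : R) n : Qplus d beta (- h) n = Qplus d beta h n.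
Proof.
have ZE (x : R) : cw_Z d beta (- x) n = cw_Z d beta x n.
  rewrite !cw_Z_level (reindex_inj rev_ord_inj)/=; apply: eq_bigr => k _.
  by rewrite subSS level_weightN// -ltnS.
have le (x : R) : Qplus d beta (- x) n <= Qplus d beta x n.
  apply: Qplus_le => k kn; rewrite ZE -{1}(subKn kn) level_weightN ?leq_subr//.
  by apply: level_le_Qplus; exact: leq_subr.
by apply/eqP; rewrite eq_le le -{1}[h]opprK le.
Qed.

Lemma Qplus_norm d (beta h : R) n : Qplus d beta `|h| n = Qplus d beta h n.
Proof.
have [h0|h0] := leP 0 h; first by rewrite ger0_norm.
by rewrite ltr0_norm// Qplus_oppr.
Qed.

(** [Qplus] is the largest level weight over the total weight, and the weight of
    the reference level is the largest one up to a factor tending to 1. *)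
Lemma Qplus_cvg d (beta h : R) (s : nat -> R) (k0 : nat -> nat) (L : R) :
  let w := level_weight (2 * d%:R * beta) h in
  (forall n, (k0 n <= n)%N) -> 0 < L -> (\forall n \near \oo, 0 < s n) ->
  (forall eps, 0 < eps -> \forall n \near \oo,
    forall k, (k <= n)%N -> w n k <= w n (k0 n) * expR eps) ->
  (s n)^-1 * ((\sum_(k < n.+1) w n k) / w n (k0 n)) @[n --> \oo] --> L ->
  Qplus d beta h n * s n @[n --> \oo] --> L^-1.
Proof.
move=> w k0n L0 s0 wle cL.
pose Lo n := w n (k0 n) / cw_Z d beta h n * s n.
have cLo : Lo n @[n --> \oo] --> L^-1.
  rewrite (_ : Lo = fun n =>
      ((s n)^-1 * ((\sum_(k < n.+1) w n k) / w n (k0 n)))^-1).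
    by apply: cvgV => //; rewrite gt_eqF.
  apply/funext => n; rewrite /Lo cw_Z_level [RHS]invfM invrK invf_div.
  exact: mulrC.
have Z0 n : 0 < cw_Z d beta h n by exact: cw_Z_gt0.
have w0 n : 0 < w n (k0 n) by exact: level_weight_gt0.
have lo n : 0 < s n -> Lo n <= Qplus d beta h n * s n.
  by move=> sn; rewrite /Lo ler_pM2r//; exact: level_le_Qplus.
have cdiff : Qplus d beta h n * s n - Lo n @[n --> \oo] --> (0 : R).
  apply/cvgr0Pnorm_le => eps e0.
  pose M := L^-1 + 1; have M0 : 0 < M by rewrite addr_gt0// invr_gt0.
  pose eta := ln (1 + eps / M).
  have eM : 0 < eps / M by rewrite divr_gt0.
  have eta0 : 0 < eta by rewrite ln_gt0// ltrDl.
  have eE : expR eta = 1 + eps / M by rewrite lnK// posrE addr_gt0.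
  near=> n; have sn : 0 < s n by near: n.
  have wn : forall k, (k <= n)%N -> w n k <= w n (k0 n) * expR eta.
    by near: n; exact: wle.
  have hi : Qplus d beta h n * s n <= Lo n * expR eta.
    rewrite /Lo mulrAC ler_pM2r// mulrAC; apply: Qplus_le => k kn.
    by rewrite ler_pM2r ?invr_gt0//; exact: wn.
  have LM : Lo n <= M.
    by near: n; have := cvgr_le _ cLo; apply; rewrite /M; lra.
  rewrite ger0_norm ?subr_ge0 ?lo//.
  have : Lo n * (eps / M) <= eps.
    by rewrite mulrCA ler_piMr ?(ltW e0)// ler_pdivrMr// mul1r.
  by move: hi; rewrite eE mulrDr mulr1; lra.
rewrite (_ : (fun n => Qplus d beta h n * s n) =
    fun n => (Qplus d beta h n * s n - Lo n) + Lo n); last first.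
  by apply/funext => n; rewrite subrK.
by rewrite -[X in _ --> X]add0r; exact: cvgD.
Unshelve. all: by end_near. Qed.

Lemma asymp_equiv_scale (a s : nat -> R) (K : R) (b : nat -> R) : 0 < K ->
  (\forall n \near \oo, b n = K / s n) ->
  a n * s n @[n --> \oo] --> K -> asymp_equiv a b.
Proof.
move=> K0 bE ca; rewrite /asymp_equiv.
apply: (@cvg_trans _ ((a n * s n * K^-1) @[n --> \oo])).
  apply: near_eq_cvg; near=> n.
  have -> : b n = K / s n by near: n.
  by rewrite invf_div mulrA.
have : a n * s n * K^-1 @[n --> \oo] --> K * K^-1.
  by apply: cvgM => //; exact: cvg_cst.
by rewrite divff// gt_eqF.
Unshelve. all: by end_near. Qed.

(** The root is simple, so [p = 0]: the slope [- a] at [z] controls both sides of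
    the peak. *)
Lemma Qplus_gaussian d (beta h z q : R) : let b := 2 * d%:R * beta in
  let a := (1 - z ^+ 2)^-1 - b in
  0 <= b -> 0 <= h -> 0 <= z < 1 -> mf_field b h z = 0 -> 0 < a ->
  (h = 0 /\ q = 1) \/ [/\ 0 < h, 0 < z & q = 0] ->
  Qplus d beta h n * scale 0 n @[n --> \oo] -->
  (Num.sqrt (pi / (2 * a)) / 2 * (1 + q) * (1 + (0 < z)%R%:R))^-1.
Proof.
move=> b a b0 h0 /andP[z0 z1] gz a0 hq.
have q0 : 0 <= q by case: hq => [[_ ->]|[_ _ ->]].
have zN1 : -1 < z < 1 by rewrite z1 (lt_le_trans (ltrN10 _)).
have IE : Rintegral (@lebesgue_measure R) `[0, +oo[ (@laplace_fun R a 0) =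
    Num.sqrt (pi / (2 * a)) / 2.
  have E : 2 ^+ 2 * a / 2%:R = 2 * a by field.
  rewrite -Rintegral_gauss ?mulr_gt0//; apply: eq_Rintegral => t _.
  by rewrite /laplace_fun E.
have sq0 : 0 < Num.sqrt (pi / (2 * a)) :> R.
  by rewrite sqrtr_gt0 divr_gt0 ?mulr_gt0// pi_gt0.
have gloc s : s = 1 \/ s = -1 -> forall eps, 0 < eps -> exists2 delta, 0 < delta &
    forall x, 0 <= x <= delta ->
    `|s * mf_field b h (z + s * x) + a * x ^+ 1| <= eps * x ^+ 1.
  move=> s1 eps e0; have [delta d0 H] := mf_field_local b h z eps zN1 gz e0.
  have sn : `|s| = 1 by case: s1 => ->; rewrite ?normrN normr1.
  have ss : s * s = 1 by case: s1 => ->; rewrite ?mulrNN mulr1.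
  exists delta => // x /andP[x0 xd]; rewrite !expr1.
  have := H (s * x); rewrite normrM sn mul1r ger0_norm// => /(_ xd).
  rewrite -/a => {}H; rewrite -[a * x]mul1r -ss -[s * s * _]mulrA -mulrDr.
  by rewrite normrM sn mul1r mulrCA.
have [c [c0 ca cm]] : exists c, [/\ 0 < c, c <= a & 0 < z ->
    c <= mf_field b h (z / 2) / (z / 2)].
  have [->|zn] := eqVneq z 0; first by exists a; split; rewrite ?ltxx.
  have zp : 0 < z by rewrite lt_neqAle eq_sym zn.
  have m0 := mf_field_mid b h z zp z1 gz h0.
  exists (Num.min a (mf_field b h (z / 2) / (z / 2))); split.
  - by rewrite lt_min a0/= !divr_gt0.
  - by rewrite ge_min lexx.
  - by rewrite ge_min lexx orbT.
have gle x : 0 <= x -> z + x < 1 -> mf_field b h (z + x) <= - c * x ^+ 1.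
  move=> x0 zx; rewrite expr1.
  apply: le_trans (mf_field_tangent b h z (z + x) z0 gz _ zx) _; first by rewrite lerDl.
  by rewrite addrAC subrr add0r ler_wpM2r// lerN2.
have gleft : z = 0 \/ [/\ 0 < z,
   forall eps, 0 < eps -> exists2 delta, 0 < delta &
     forall x, 0 <= x <= delta -> `|- mf_field b h (z - x) + a * x ^+ 1| <= eps * x ^+ 1,
   forall y, z / 2 <= y <= z -> c * (z - y) ^+ 1 <= mf_field b h y &
   forall y, 0 <= y <= z -> 0 <= mf_field b h y].
  have [->|zn] := eqVneq z 0; [by left|right].
  have zp : 0 < z by rewrite lt_neqAle eq_sym zn.
  split => //.
  - move=> eps e0; have [|delta d0 H] := gloc (-1) _ eps e0; first by right.
    by exists delta => // x /H; rewrite !mulN1r.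
  - move=> y yz; apply: le_trans (mf_field_chord b h z zp z1 gz y yz).
    by rewrite expr1 ler_wpM2r ?cm// subr_ge0; case/andP: yz.
  - by move=> y; exact: mf_field_ge0.
have gloc1 : forall eps, 0 < eps -> exists2 delta, 0 < delta &
   forall x, 0 <= x <= delta -> `|mf_field b h (z + x) + a * x ^+ 1| <= eps * x ^+ 1.
  move=> eps e0; have [|delta d0 H] := gloc 1 _ eps e0; first by left.
  by exists delta => // x /H; rewrite !mul1r.
apply: (@Qplus_cvg d beta h (scale 0) (ref_level z)).
- exact: ref_level_le.
- by rewrite !mulr_gt0 ?divr_gt0// ltr_pwDl.
- exact: near_scale_gt0.
- exact: (level_weight_le_ref b h z a c 0 b0 h0 z0 z1 a0 c0 gloc1 gle gleft).
- rewrite -IE; exact: (total_weight_cvg b h z a c 0 b0 h0 z0 z1 a0 c0 gloc1 gle gleft q hq).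
Qed.

(** At criticality the field is [- y ^+ 3 / 3] up to higher order, so [p = 2] and
    the peak is at the origin. *)
Lemma Qplus_critical d (beta : R) : 2 * d%:R * beta = 1 ->
  Qplus d beta 0 n * scale 2 n @[n --> \oo] -->
  ((4 / 3) `^ (- (1 / 4)) / 4 * Gamma (1 / 4) * 2)^-1.
Proof.
move=> b1; have k0 : 0 < 3^-1 :> R by rewrite invr_gt0.
have IE : Rintegral (@lebesgue_measure R) `[0, +oo[ (@laplace_fun R 3^-1 2) =
    (4 / 3) `^ (- (1 / 4)) / 4 * Gamma (1 / 4).
  have E : 2 ^+ 4 * 3^-1 / 4%:R = 4 / 3 :> R by field.
  rewrite -Rintegral_quartic ?divr_gt0//; apply: eq_Rintegral => t _.
  by rewrite /laplace_fun E.
have I0 : 0 < Rintegral (@lebesgue_measure R) `[0, +oo[ (@laplace_fun R 3^-1 2).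
  by apply: Rintegral_expRNX_gt0; rewrite divr_gt0// mulr_gt0// exprn_gt0.
have gle x : 0 <= x -> 0 + x < 1 -> mf_field (2 * d%:R * beta) 0 (0 + x) <= - 3^-1 * x ^+ 3 :> R.
  by rewrite add0r b1 => x0 x1; apply: mf_field_critical_le; rewrite x0.
have gloc : forall eps : R, 0 < eps -> exists2 delta, 0 < delta &
   forall x, 0 <= x <= delta ->
   `|mf_field (2 * d%:R * beta) 0 (0 + x) + 3^-1 * x ^+ 3| <= eps * x ^+ 3.
  move=> eps e0; have [delta d0 H] := mf_field_critical_local eps e0.
  by exists delta => // x xd; rewrite add0r b1 H.
have b0 : 0 <= 2 * d%:R * beta :> R by rewrite b1.
apply: (@Qplus_cvg d beta 0 (scale 2) (ref_level 0)).
- by apply: ref_level_le.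
- by rewrite -IE mulr_gt0.
- exact: near_scale_gt0.
- exact: (level_weight_le_ref _ 0 0 3^-1 3^-1 2 b0 (lexx _) (lexx _) ltr01 k0 k0 gloc gle (or_introl erefl)).
- have := total_weight_cvg _ 0 0 3^-1 3^-1 2 b0 (lexx _) (lexx _) ltr01 k0 k0 gloc gle (or_introl erefl) 1 (or_introl (conj erefl erefl)).
  by rewrite ltxx addr0 mulr1 IE -[1 + 1]/(2 : R).
Qed.

Lemma Gamma_quarter_gt0 : 0 < Gamma (1 / 4) :> R.
Proof.
have := @Rintegral_expRNX_gt0 R 1 3 ltr01.
by rewrite Rintegral_quartic// powR1 pmulr_rgt0// divr_gt0.
Qed.

Lemma scale0_powR n : @scale R 0 n = n%:R `^ (1 / 2).
Proof. by rewrite /scale expr1 /scale_root div1r. Qed.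

Lemma scale2_powR n : @scale R 2 n = n%:R `^ (3 / 4).
Proof.
rewrite /scale /scale_root -powR_mulrn ?powR_ge0// -powRrM.
by rewrite mulrC.
Qed.

Lemma sqrt_pi_inv (a : R) : 0 < a ->
  (Num.sqrt (pi / (2 * a)))^-1 = Num.sqrt (2 * a / pi).
Proof.
move=> a0; rewrite -sqrtrV ?invf_div//.
by rewrite divr_ge0 ?pi_ge0// mulr_ge0// ltW.
Qed.

End Conclusion.

Theorem theorem1p3 (R : realType) (d : nat) (beta h : R)
    (hd : (1 <= d)%N) (hbeta : 0 <= beta) :
  [/\ h = 0 -> beta < beta_c d ->
        asymp_equiv (Qplus d beta h)
          (fun n => Num.sqrt (2 * (1 - 2 * d%:R * beta) / pi)
                    * n%:R `^ (- (1 / 2))),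
      h = 0 -> beta = beta_c d ->
        asymp_equiv (Qplus d beta h)
          (fun n => 2 / ((3 / 4) `^ (1 / 4) * Gamma (1 / 4))
                    * n%:R `^ (- (3 / 4))),
      h = 0 -> beta_c d < beta ->
        exists2 z : R,
          is_max_solution (fun w => tanh (beta / beta_c d * w)) z &
          asymp_equiv (Qplus d beta h)
            (fun n => Num.sqrt ((1 / (1 - z ^+ 2) - 2 * d%:R * beta) / (2 * pi))
                      * n%:R `^ (- (1 / 2)))
    & h != 0 ->
        exists2 z : R,
          is_max_solution (fun w => tanh (beta / beta_c d * w + `|h|)) z &
          asymp_equiv (Qplus d beta h)
            (fun n => Num.sqrt (2 * (1 / (1 - z ^+ 2) - 2 * d%:R * beta) / pi)
                      * n%:R `^ (- (1 / 2)))].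
Proof.
pose b := 2 * d%:R * beta.
have d0 : 0 < 2 * d%:R :> R by rewrite mulr_gt0// ltr0n.
have bE : beta / beta_c d = b.
  by rewrite /beta_c /b div1r invrK mulrC.
have b0 : 0 <= b by rewrite !mulr_ge0.
have b_lt1 : (beta < beta_c d) = (b < 1).
  by rewrite /beta_c ltr_pdivlMr// mulrC.
have b_gt1 : (beta_c d < beta) = (1 < b).
  by rewrite /beta_c ltr_pdivrMr// mulrC.
have pi0 := @pi_gt0 R.
have divr_scale (x y : R) : 0 < y -> 2 ^+ 2 * (x / (2 * y)) = 2 * x / y.
  by move=> y0; field; exact: lt0r_neq0.
split.
- move=> h0; rewrite b_lt1 => b1.
  have a0 : 0 < (1 - 0 ^+ 2)^-1 - b by rewrite expr0n/= subr0 invr1 subr_gt0.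
  have g0 : mf_field b 0 0 = 0 by rewrite mf_field0.
  have z01 : 0 <= (0 : R) < 1 by rewrite lexx ltr01.
  have := @Qplus_gaussian R d beta 0 0 1 b0 (lexx _) z01 g0 a0 (or_introl (conj erefl erefl)).
  rewrite ltxx addr0 mulr1 -[1 + 1]/(2 : R) divfK ?pnatr_eq0//.
  rewrite sqrt_pi_inv// expr0n/= subr0 invr1 -/b h0.
  apply: asymp_equiv_scale; first by rewrite sqrtr_gt0 divr_gt0// mulr_gt0// subr_gt0.
  by apply: nearW => n; rewrite scale0_powR powRN.
- move=> h0 bc; have b1 : b = 1 by rewrite -bE bc divff// gt_eqF// divr_gt0.
  have := @Qplus_critical R d beta b1; rewrite h0.
  have -> : ((4 / 3) `^ (- (1 / 4)) / 4 * Gamma (1 / 4) * 2)^-1 =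
      2 / ((3 / 4) `^ (1 / 4) * Gamma (1 / 4)) :> R.
    have -> : (4 / 3) `^ (- (1 / 4)) = (3 / 4) `^ (1 / 4) :> R.
      rewrite -mulN1r powRrM powR_inv1 ?divr_ge0// invf_div//.
    have P0 : (3 / 4) `^ (1 / 4) != 0 :> R by rewrite gt_eqF// powR_gt0// divr_gt0.
    have G0 := lt0r_neq0 (@Gamma_quarter_gt0 R).
    by field; rewrite P0 G0.
  apply: asymp_equiv_scale.
    by rewrite divr_gt0// mulr_gt0 ?Gamma_quarter_gt0// powR_gt0// divr_gt0.
  by apply: nearW => n; rewrite scale2_powR powRN.
- move=> h0; rewrite b_gt1 => b1.
  have [z [z0 z1 gz]] := @mf_root_exists R b 0 (or_intror (conj erefl b1)) b0.
  have a0 := @mf_curvature_gt0 R b 0 z z0 z1 gz (lexx _).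
  have z01 : 0 <= z < 1 by rewrite ltW.
  exists z.
    have := @mf_root_max R b 0 z z01 gz; rewrite bE -subr_gt0 => /(_ a0).
    by under [in X in X -> _]eq_fun do rewrite addr0.
  have := @Qplus_gaussian R d beta 0 z 1 b0 (lexx _) z01 gz a0 (or_introl (conj erefl erefl)).
  rewrite z0 -/b h0 div1r; set a := (1 - z ^+ 2)^-1 - b in a0 *.
  have -> : (Num.sqrt (pi / (2 * a)) / 2 * (1 + 1) * (1 + true%:R))^-1 =
      Num.sqrt (a / (2 * pi)).
    rewrite -[1 + 1]/(2 : R) divfK ?pnatr_eq0// invfM sqrt_pi_inv//.
    rewrite -divr_scale//.
    rewrite sqrtrM ?sqr_ge0// sqrtr_sqr ger0_norm// mulrAC divff ?mul1r//.
  apply: asymp_equiv_scale; first by rewrite sqrtr_gt0 divr_gt0// mulr_gt0.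
  by apply: nearW => n; rewrite scale0_powR powRN.
- move=> hn; have h0 : 0 < `|h| by rewrite normr_gt0.
  have [z [z0 z1 gz]] := @mf_root_exists R b `|h| (or_introl h0) b0.
  have a0 := @mf_curvature_gt0 R b `|h| z z0 z1 gz (ltW h0).
  have z01 : 0 <= z < 1 by rewrite ltW.
  exists z.
    by have := @mf_root_max R b `|h| z z01 gz; rewrite bE -subr_gt0 => /(_ a0).
  have := @Qplus_gaussian R d beta `|h| z 0 b0 (ltW h0) z01 gz a0
    (or_intror (And3 h0 z0 erefl)).
  rewrite z0 -/b div1r addr0 mulr1; set a := (1 - z ^+ 2)^-1 - b in a0 *.
  rewrite -[1 + true%:R]/(2 : R) divfK ?pnatr_eq0// sqrt_pi_inv//.
  under eq_cvg do rewrite Qplus_norm.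
  apply: asymp_equiv_scale; first by rewrite sqrtr_gt0 divr_gt0// mulr_gt0.
  by apply: nearW => n; rewrite scale0_powR powRN.
Qed.
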